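(* There does not exist a tile that is radially generated by three distinct points (vertices of its boundary) and that tiles the disk.
   Context: Tile: if $\gamma$ is a simple closed plane curve bounding an open contractible region $U$, the closure $\overline U=U\cup\gamma$ is called a tile, with boundary $\gamma$. A monohedral tiling of a closed disk is a set of pairwise congruent tiles (congruent by an isometry, possibly orientation reversing), meeting pairwise only along their boundaries, whose union is the disk. A tile ''tiles the disk'' if copies of it (tiles congruent to it) form a monohedral tiling of a closed disk. Rotation: for an angle $\alpha$ and a point $p$, $\alpha_p$ denotes the anticlockwise rotation of the plane by $\alpha$ about $p$. Radial generation: let $\eta$ be a continuous planar curve segment with no self-intersections, $p$ a point on $\eta$, and $\alpha\in(0,2\pi)$. The union of $\eta$, $\eta'=\alpha_p(\eta)$ and the circular arcs centred at $p$ connecting the end-points of $\eta$ with the corresponding end-points of $\eta'$ is a contour $\gamma=[\eta,p,\alpha]$. It is the boundary of a tile if and only if it is simple; in that case the tile $\overline U$ is said to be radially generated by $\eta$, $p$ and $\alpha$, written $\overline U=\langle\eta,p,\alpha\rangle$. (In this case $p$ is an end-point of $\eta$ and exactly one arc is added.) A tile is radially generated by the points $p_1,p_2,p_3$ if it can be written as $\langle\eta_1,p_1,\alpha_1\rangle=\langle\eta_2,p_2,\alpha_2\rangle=\langle\eta_3,p_3,\alpha_3\rangle$ for some curve segments $\eta_i$ and angles $\alpha_i$. *)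

(* Defs.v *)
From HB Require Import structures.
From mathcomp Require Import all_boot all_order all_algebra.
From mathcomp Require Import all_classical all_reals all_analysis.

Set Implicit Arguments.
Unset Strict Implicit.
Unset Printing Implicit Defensive.

Import Order.TTheory GRing.Theory Num.Theory.
Import numFieldNormedType.Exports.

Local Open Scope classical_set_scope.
Local Open Scope ring_scope.

(* The library norm on R * R is the sup norm: it only contributes the (product)
   topology here, and all metric notions below go through [edist]. *)
Notation plane R := (R * R)%type.

Definition edist (R : realType) (x y : plane R) : R :=
  Num.sqrt ((x.1 - y.1) ^+ 2 + (x.2 - y.2) ^+ 2).

Definition closed_disk (R : realType) (c : plane R) (r : R) : set (plane R) :=
  [set x | edist c x <= r].

(* Distance preserving maps of the plane; orientation may be reversed. *)
Definition plane_isometry (R : realType) (f : plane R -> plane R) : Prop :=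
  forall x y, edist (f x) (f y) = edist x y.

Definition congruent (R : realType) (A B : set (plane R)) : Prop :=
  exists2 f : plane R -> plane R, plane_isometry f & f @` A = B.

(* Anticlockwise rotation by the angle a about p. *)
Definition rotation (R : realType) (a : R) (p x : plane R) : plane R :=
  (p.1 + (cos a * (x.1 - p.1) - sin a * (x.2 - p.2)),
   p.2 + (sin a * (x.1 - p.1) + cos a * (x.2 - p.2))).

Definition frontier (T : topologicalType) (A : set T) : set T :=
  closure A `\` interior A.

(* A is contractible in the subspace topology; in particular it is nonempty. *)
Definition contractible (R : realType) (T : topologicalType) (A : set T) :
    Prop :=
  exists x0 : T, A x0 /\
  exists H : R * T -> T,
    [/\ {within `[0, 1] `*` A, continuous H},
        forall (t : R) x, t \in `[0, 1] -> A x -> A (H (t, x)),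
        forall x, A x -> H (0, x) = x &
        forall x, A x -> H (1, x) = x0].

Definition simple_closed_curve (R : realType) (C : set (plane R)) : Prop :=
  exists g : R -> plane R,
    [/\ {within `[0, 1], continuous g},
        forall s t : R, s \in `[0, 1[ -> t \in `[0, 1[ -> g s = g t -> s = t,
        g 0 = g 1 &
        C = g @` `[0, 1]].

(* The tile itself is the closure of its region; requiring contractibility
   selects the inner of the two components of the complement of the curve. *)
Record tile (R : realType) := Tile {
  region : set (plane R);
  tile_boundary : set (plane R);
  tile_boundary_simple : simple_closed_curve tile_boundary;
  region_open : open region;
  region_contractible : contractible R region;
  region_frontier : frontier region = tile_boundary }.

Definition tile_set (R : realType) (T : tile R) : set (plane R) :=
  region T `|` tile_boundary T.

Definition monohedral_tiling (R : realType) (S : set (tile R))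
    (D : set (plane R)) : Prop :=
  [/\ forall A B, S A -> S B -> congruent (tile_set A) (tile_set B),
      forall A B, S A -> S B -> A <> B ->
        tile_set A `&` tile_set B `<=` tile_boundary A `&` tile_boundary B &
      \bigcup_(A in S) tile_set A = D].

Definition tiles_disk (R : realType) (T : tile R) : Prop :=
  exists (c : plane R) (r : R) (S : set (tile R)),
    [/\ 0 < r, monohedral_tiling S (closed_disk c r) &
        forall A, S A -> congruent (tile_set T) (tile_set A)].

Definition simple_curve_segment (R : realType) (eta : R -> plane R) : Prop :=
  {within `[0, 1], continuous eta} /\
  (forall s t : R, s \in `[0, 1] -> t \in `[0, 1] -> eta s = eta t -> s = t).

(* The arc centred at p swept anticlockwise from x to its image under the
   rotation by a about p; it is the single point p when x = p. *)
Definition swept_arc (R : realType) (p : plane R) (a : R) (x : plane R) :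
    set (plane R) :=
  [set rotation t p x | t in `[0, a]].

Definition contour (R : realType) (eta : R -> plane R) (p : plane R) (a : R) :
    set (plane R) :=
  let curve := eta @` `[0, 1] in
  curve `|` (rotation a p @` curve) `|`
  (swept_arc p a (eta 0) `|` swept_arc p a (eta 1)).

(* T = <eta, p, a>; simplicity of the contour is part of T being a tile. *)
Definition radially_generated (R : realType) (T : tile R)
    (eta : R -> plane R) (p : plane R) (a : R) : Prop :=
  [/\ simple_curve_segment eta,
      (eta @` `[0, 1]) p,
      0 < a < 2 * pi &
      tile_boundary T = contour eta p a].

Definition radially_generated_by_point (R : realType) (T : tile R)
    (p : plane R) : Prop :=
  exists (eta : R -> plane R) (a : R), radially_generated T eta p a.

Definition radially_generated_by3 (R : realType) (T : tile R)
    (p1 p2 p3 : plane R) : Prop :=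
  [/\ radially_generated_by_point T p1,
      radially_generated_by_point T p2 &
      radially_generated_by_point T p3].

(* Main.v *)
(* The tiling plays no role: no tile at all is radially generated by three
   distinct points. The rotation about a generating point p exchanges the two
   branches of the boundary issuing from p, reversing the order along the curve,
   and the rest of the boundary is an arc centred at p. Fix the radius and the
   angle of one of these three arcs, and consider the maximal circular arcs of
   the boundary with this radius and this angle. There are finitely many of them,
   say n; each has a sign, the direction in which it turns. A generating point
   induces an order-reversing involution of these arcs which changes all the
   signs, except for its own arc, which is fixed. Hence the sum of all signs is
   the sign of that arc: the arcs of the three points belong to the family and
   have the same sign e. Indexing the arcs by Z/n in cyclic order, the sign
   function f satisfies f(a + j) = - f(a - j) for j != 0 at the index a of any of
   the three arcs, so its Fourier coefficient z = sum_j f(j) w^-j, with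
   w = exp(2 i pi / n), is such that Re(w^a z) = e. A line would meet a circle in
   three points.

   The curve segments need not be rectifiable, which is why the arcs are counted
   rather than measured. *)
Require Import Defs.
From mathcomp Require Import all_boot all_order all_algebra.
From mathcomp Require Import all_classical all_reals all_analysis.
From mathcomp Require Import ring lra zify.

Set Implicit Arguments.
Unset Strict Implicit.
Unset Printing Implicit Defensive.

Import Order.TTheory GRing.Theory Num.Theory.
Import numFieldNormedType.Exports.

Local Open Scope classical_set_scope.
Local Open Scope ring_scope.

(** * Plane rotations, and circles cut by lines *)

Section Geometry.
Variable R : realType.
Implicit Types (a b u v : R) (p o x y : plane R).

(** Radial generation says nothing about how the pieces lie along the boundary. That the two
    branches leave the centre in opposite directions and do not overlap, that the arc fills the gap
    between them, and that the centre is an end-point of the segment all have to be proved. The tool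
    is a 1-periodic parameter of the boundary: it turns order along the curve into the order of the
    reals, and a continuous injection of an interval into the reals is monotone.

    The involution acts on whole arcs because neither the centre nor an end of its arc is an inner
    point of any circular arc of the boundary. So no maximal arc straddles two of the three parts,
    and the rotation carries each arc of a branch to a full maximal arc. The rotation keeps the
    sense of turning while the order along the curve is reversed, hence the change of sign.

    Finiteness comes from the fixed radius and angle: such arcs contain a chord of fixed length, so
    they cannot accumulate. On ranks the involution is [j -> 2 a - j] modulo [n], for which the
    cosine of the angle from index [a] is even; in the real part of the Fourier coefficient all
    terms but one cancel. *)

Definition sqdist x y : R := (x.1 - y.1) ^+ 2 + (x.2 - y.2) ^+ 2.

Lemma planeP x y : x.1 = y.1 -> x.2 = y.2 -> x = y.
Proof. by case: x y => [? ?] [? ?] /= -> ->. Qed.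

Lemma sqdist_ge0 x y : 0 <= sqdist x y.
Proof. by rewrite addr_ge0 ?sqr_ge0. Qed.

Lemma sqdist_eq0 x y : sqdist x y = 0 -> x = y.
Proof.
move/eqP; rewrite paddr_eq0 ?sqr_ge0 // !sqrf_eq0 !subr_eq0.
by case/andP => /eqP ? /eqP ?; exact: planeP.
Qed.

Lemma sqdist_xx x : sqdist x x = 0.
Proof. by rewrite /sqdist !subrr expr0n /= addr0. Qed.

Lemma sqdist_gt0 x y : x <> y -> 0 < sqdist x y.
Proof.
move=> xy; rewrite lt_neqAle sqdist_ge0 andbT eq_sym; apply/eqP.
by move/sqdist_eq0.
Qed.

Lemma rotationD a b p x :
  rotation a p (rotation b p x) = rotation (a + b) p x.
Proof. by rewrite /rotation /= cosD sinD; apply: planeP => /=; ring. Qed.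

Lemma rotation0 p x : rotation 0 p x = x.
Proof. by rewrite /rotation cos0 sin0; apply: planeP => /=; ring. Qed.

Lemma rotation_center a p : rotation a p p = p.
Proof. by rewrite /rotation; apply: planeP => /=; ring. Qed.

Lemma rotationK a p : cancel (rotation a p) (rotation (- a) p).
Proof. by move=> x; rewrite rotationD addNr rotation0. Qed.

Lemma rotationNK a p : cancel (rotation (- a) p) (rotation a p).
Proof. by move=> x; rewrite rotationD subrr rotation0. Qed.

Lemma rotation_conj a p u o x :
  rotation a p (rotation u o x) =
  rotation u (rotation a p o) (rotation a p x).
Proof. by rewrite /rotation; apply: planeP => /=; ring. Qed.

Lemma sqdist_rotation a p x y :
  sqdist (rotation a p x) (rotation a p y) = sqdist x y.
Proof.
rewrite /sqdist /rotation /=.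
transitivity ((cos a ^+ 2 + sin a ^+ 2) *
  ((x.1 - y.1) ^+ 2 + (x.2 - y.2) ^+ 2)); first by ring.
by rewrite cos2Dsin2 mul1r.
Qed.

Lemma sqdist_rotation_center a p x : sqdist p (rotation a p x) = sqdist p x.
Proof. by rewrite -{1}(rotation_center a p) sqdist_rotation. Qed.

Lemma cos_eq1 a : cos a = 1 -> `|a| < 2 * pi -> a = 0.
Proof.
move=> ca la.
have s0 : sin (a / 2) = 0.
  have : cos (a / 2 + a / 2) = 1 by rewrite -splitr.
  rewrite cosD => h; have := cos2Dsin2 (a / 2); rewrite !expr2 => h2.
  by apply/eqP; rewrite -sqrf_eq0 expr2; apply/eqP; lra.
have [a0|a0|//] := ltgtP a 0.
- have : 0 < sin (- (a / 2)).
    by apply: sin_gt0_pi; move: la; rewrite ltr0_norm //; lra.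
  by rewrite sinN s0 oppr0 ltxx.
- have : 0 < sin (a / 2).
    by apply: sin_gt0_pi; move: la; rewrite gtr0_norm //; lra.
  by rewrite s0 ltxx.
Qed.

Lemma rotation_fixed a p x :
  x <> p -> `|a| < 2 * pi -> rotation a p x = x -> a = 0.
Proof.
move=> xp la e; apply: cos_eq1 => //.
have := sqdist_gt0 xp; rewrite /sqdist => dp.
have e1 : cos a * (x.1 - p.1) - sin a * (x.2 - p.2) = x.1 - p.1.
  by rewrite -[in RHS]e /rotation /=; ring.
have e2 : sin a * (x.1 - p.1) + cos a * (x.2 - p.2) = x.2 - p.2.
  by rewrite -[in RHS]e /rotation /=; ring.
apply: (mulIf (lt0r_neq0 dp)); rewrite mul1r.
transitivity ((x.1 - p.1) * (cos a * (x.1 - p.1) - sin a * (x.2 - p.2)) +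
  (x.2 - p.2) * (sin a * (x.1 - p.1) + cos a * (x.2 - p.2))); first by ring.
by rewrite e1 e2; ring.
Qed.

Lemma rotation_inj_angle u v p x :
  x <> p -> `|u - v| < 2 * pi -> rotation u p x = rotation v p x -> u = v.
Proof.
move=> xp la e; apply/eqP; rewrite -subr_eq0; apply/eqP.
apply: (rotation_fixed xp la).
by rewrite addrC -rotationD e rotationK.
Qed.

(** [a + a - 2 * pi] lies strictly between [- 2 * pi] and [2 * pi], so it vanishes. The half-turn is
    the case where the end-points alone do not tell an arc from its reverse; an inner point then
    decides. *)
Lemma rotation_double a p x :
  x <> p -> 0 < a < 2 * pi -> rotation (a + a) p x = x -> a = pi.
Proof.
move=> xp /andP[a0 a2] faa.
have fix2 : rotation (a + a - 2 * pi) p x = x.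
  rewrite -[RHS]faa -[in RHS](subrK (2 * pi) (a + a)).
  by rewrite /rotation !(mulr_natl pi 2) cosD2pi sinD2pi.
have : a + a - 2 * pi = 0.
  by apply: (rotation_fixed xp) fix2; rewrite ltr_norml; apply/andP; split; lra.
by lra.
Qed.

Lemma rotation_neq a p x : rotation a p x <> p <-> x <> p.
Proof.
split=> h e; apply: h; first by rewrite e rotation_center.
by rewrite -(rotationK a p x) e rotation_center.
Qed.

(** A point of the line is [x] plus a multiple [c] of [w] turned by a right angle. The circle
    equation becomes [c] times an affine function of [c], so the nonzero roots given by [y] and [z]
    agree. *)
Lemma line_circle o w k r2 x y z :
  w <> (0, 0) :> plane R -> x <> y -> x <> z -> y <> z ->
  (forall t, t \in [:: x; y; z] -> t.1 * w.1 + t.2 * w.2 = k) ->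
  (forall t, t \in [:: x; y; z] -> sqdist o t = r2) -> False.
Proof.
move=> w0 xy xz yz hl hc.
have W : 0 < w.1 ^+ 2 + w.2 ^+ 2.
  have : 0 < sqdist w (0, 0) by apply: sqdist_gt0.
  by rewrite /sqdist /= !subr0.
have key t : t \in [:: x; y; z] -> exists c : R,
    t = (x.1 - c * w.2, x.2 + c * w.1).
  move=> tin; have e1 := hl _ tin; have e2 : x.1 * w.1 + x.2 * w.2 = k.
    by apply: hl; rewrite inE eqxx.
  exists (((t.2 - x.2) * w.1 - (t.1 - x.1) * w.2) / (w.1 ^+ 2 + w.2 ^+ 2)).
  have e0 : (t.1 - x.1) * w.1 + (t.2 - x.2) * w.2 = 0.
    by rewrite -(subrr k) -{1}e1 -e2; ring.
  have W0 := lt0r_neq0 W.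
  apply: planeP => /=; apply/eqP; rewrite -subr_eq0; apply/eqP.
    transitivity (((t.1 - x.1) * w.1 + (t.2 - x.2) * w.2) * w.1
      / (w.1 ^+ 2 + w.2 ^+ 2)); first by field.
    by rewrite e0 !mul0r.
  transitivity (((t.1 - x.1) * w.1 + (t.2 - x.2) * w.2) * w.2
    / (w.1 ^+ 2 + w.2 ^+ 2)); first by field.
  by rewrite e0 !mul0r.
have [cy ey] := key y ltac:(by rewrite !inE eqxx orbT).
have [cz ez] := key z ltac:(by rewrite !inE eqxx !orbT).
have cy0 : cy != 0.
  apply/eqP => c0; apply: xy; rewrite ey c0.
  by apply: planeP => /=; ring.
have cz0 : cz != 0.
  apply/eqP => c0; apply: xz; rewrite ez c0.
  by apply: planeP => /=; ring.
have Ex := hc x ltac:(by rewrite !inE eqxx).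
have red c : c != 0 -> sqdist o (x.1 - c * w.2, x.2 + c * w.1) = r2 ->
    c * (w.1 ^+ 2 + w.2 ^+ 2) = 2 * ((x.1 - o.1) * w.2 - (x.2 - o.2) * w.1).
  move=> c0 e; apply: (mulfI c0).
  apply/eqP; rewrite -subr_eq0; apply/eqP.
  by rewrite -(subrr r2) -{1}e -Ex /sqdist /=; ring.
have ry := red _ cy0 (etrans (congr1 (sqdist o) (esym ey))
  (hc y ltac:(by rewrite !inE eqxx orbT))).
have rz := red _ cz0 (etrans (congr1 (sqdist o) (esym ez))
  (hc z ltac:(by rewrite !inE eqxx !orbT))).
have : cy = cz by apply: (mulIf (lt0r_neq0 W)); rewrite ry rz.
by move=> e; apply: yz; rewrite ey ez e.
Qed.

(** Subtracting the two circle equations puts the three points on the radical axis, a line with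
    normal [o - o']. *)
Lemma circle_center_unique o o' r2 r2' x y z :
  x <> y -> x <> z -> y <> z ->
  (forall t, t \in [:: x; y; z] -> sqdist o t = r2 /\ sqdist o' t = r2') ->
  o = o'.
Proof.
move=> xy xz yz h; apply: contrapT => oo'.
apply: (@line_circle o (o.1 - o'.1, o.2 - o'.2)
  ((r2' - r2 + (o.1 ^+ 2 + o.2 ^+ 2) - (o'.1 ^+ 2 + o'.2 ^+ 2)) / 2)
  r2 x y z) => //.
- case=> /eqP; rewrite subr_eq0 => /eqP e1 /eqP.
  by rewrite subr_eq0 => /eqP e2; apply: oo'; exact: planeP.
- by move=> t /h[<- <-]; rewrite /sqdist /=; field.
- by move=> t /h[].
Qed.

Lemma continuous_plane (T : topologicalType) (f : T -> plane R) (t : T) :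
  {for t, continuous (fun s => (f s).1)} ->
  {for t, continuous (fun s => (f s).2)} -> {for t, continuous f}.
Proof.
move=> h1 h2; rewrite /prop_for /continuous_at (surjective_pairing (f t)).
have -> : f = fun s => ((f s).1, (f s).2).
  by apply/funext => s; rewrite -surjective_pairing.
exact: cvg_pair h1 h2.
Qed.

Lemma continuous_rotation_angle p x : continuous (fun u => rotation u p x).
Proof.
move=> u; apply: continuous_plane; rewrite /rotation /=;
  apply: cvgD; try exact: cvg_cst;
  [apply: cvgB|apply: cvgD]; apply: cvgM; try exact: cvg_cst;
  (exact: continuous_cos || exact: continuous_sin).
Qed.

Lemma continuous_rotation a p : continuous (rotation a p).
Proof.
move=> x; apply: continuous_plane; rewrite /rotation /=;
  apply: cvgD; try exact: cvg_cst;
  [apply: cvgB|apply: cvgD]; apply: cvgM; try exact: cvg_cst;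
  apply: cvgB; try exact: cvg_cst; (exact: cvg_fst || exact: cvg_snd).
Qed.

Lemma continuous_sqdist p : continuous (sqdist p).
Proof.
move=> x; rewrite /prop_for /continuous_at /sqdist; under eq_cvg do rewrite !expr2.
rewrite !expr2.
apply: cvgD; apply: cvgM; apply: cvgB; try exact: cvg_cst;
 (exact: cvg_fst || exact: cvg_snd).
Qed.

End Geometry.

(** * Periodic parameters of a simple closed curve *)

Section PeriodicParam.
Variable R : realType.
Implicit Types (H : R -> plane R) (s t T : R) (x y : plane R).

(** A homeomorphism of [R/Z] onto the curve, unrolled: any point can be the origin of a window [[T,
    T + 1[] in which order along the curve is that of the reals. *)
Definition periodic_param H :=
  continuous H /\ forall s t, H s = H t <-> exists k : int, s - t = k%:~R.

Lemma int_lt1 (k : int) : -1 < k%:~R :> R -> k%:~R < 1 :> R -> k = 0.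
Proof.
have -> : -1 = (-1)%:~R :> R by rewrite mulrN1z.
rewrite (_ : 1 = 1%:~R :> R) // !ltr_int => h1 h2.
by case: k h1 h2 => [[|k]|[|k]].
Qed.

Lemma periodic_param_opp H :
  periodic_param H -> periodic_param (fun s => H (- s)).
Proof.
move=> [cH iH]; split.
  by move=> s; apply: continuous_comp; [exact: opp_continuous|exact: cH].
move=> s t; rewrite iH; split=> -[k e].
  by exists (- k); rewrite mulrNz -e; ring.
by exists (- k); rewrite mulrNz -e; ring.
Qed.

Lemma continuous_within_glue (g : R -> plane R) (a b c : R) :
  a < b -> b < c -> {within `[a, b], continuous g} ->
  {within `[b, c], continuous g} -> {for b, continuous g}.
Proof.
move=> ab bc /subspace_continuousP g1 /subspace_continuousP g2 V gbV.
have b1 : `[a, b]%classic b by rewrite /= in_itv /= lexx ltW.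
have b2 : `[b, c]%classic b by rewrite /= in_itv /= lexx ltW.
have h1 : \forall x \near b, `[a, b]%classic x -> V (g x) by exact: (g1 b b1 _ gbV).
have h2 : \forall x \near b, `[b, c]%classic x -> V (g x) by exact: (g2 b b2 _ gbV).
have h3 : \forall x \near b, x \in `]a, c[.
  by apply: near_in_itvoo; rewrite in_itv /= ab bc.
change (\forall x \near b, V (g x)).
apply: filterS3 h1 h2 h3 => x hx1 hx2; rewrite in_itv /= => /andP[ax xc].
have [xb|bx] := leP x b.
  by apply: hx1; rewrite /= in_itv /= (ltW ax).
by apply: hx2; rewrite /= in_itv /= (ltW bx) ltW.
Qed.

Lemma simple_closed_periodic_param (C : set (plane R)) :
  simple_closed_curve C -> exists H, periodic_param H /\ range H = C.
Proof.
move=> [g [cg ig g01 ->]].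
have fl t : 0 <= t - (Num.floor t)%:~R < 1.
  have /andP[h1 h2] := floor_itv t.
  by rewrite subr_ge0 h1 /= ltrBlDl; move: h2; rewrite intrD.
exists (fun t => g (t - (Num.floor t)%:~R)); split; last first.
  apply/seteqP; split=> x /=.
    move=> [t _ <-]; exists (t - (Num.floor t)%:~R) => //.
    by rewrite /= in_itv /=; have /andP[-> /ltW ->] := fl t.
  move=> [t]; rewrite /= in_itv /= => /andP[t0 t1] <-.
  have [t1'|t1'] := ltP t 1.
    exists t => //; rewrite (_ : Num.floor t = 0) ?subr0 //.
    by apply: Num.Theory.floor_def; rewrite t0.
  exists 0 => //; rewrite Num.Theory.floor0 subr0 g01; congr g.
  by apply/eqP; rewrite eq_le t1 t1'.
have flD t (k : int) : Num.floor (t + k%:~R) = Num.floor t + k.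
  apply: Num.Theory.floor_def; have := fl t; rewrite !intrD => /andP[h1 h2].
  by apply/andP; split; lra.
split; last first.
  move=> s t; split.
    move=> e; exists (Num.floor s - Num.floor t); rewrite intrB.
    have /eqP : s - (Num.floor s)%:~R = t - (Num.floor t)%:~R.
      by apply: ig => //; rewrite in_itv /= fl.
    by move=> /eqP h; lra.
  move=> [k e]; have -> : s = t + k%:~R by rewrite -e; ring.
  by rewrite flD intrD; congr g; ring.
(* At the right end the floor jumps, yet the value is still [g (t - k)] because [g 0 = g 1]. *)
have on k : {within `[k%:~R, (k%:~R : R) + 1],
    continuous (fun t => g (t - (Num.floor t)%:~R))}.
  apply: (@subspace_eq_continuous _ _ _ (g \o (fun t => t - k%:~R))).
    move=> t; rewrite inE /= in_itv /= => /andP[t0 t1].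
    change (g (t - k%:~R) = g (t - (Num.floor t)%:~R)).
    move: t1; rewrite le_eqVlt => /predU1P[->|t1].
      rewrite (_ : Num.floor _ = k + 1); last first.
        by apply: Num.Theory.floor_def; rewrite !intrD lexx ltrDl /=.
      have -> : k%:~R + 1 - k%:~R = 1 :> R by ring.
      by rewrite intrD -g01; congr g; ring.
    by rewrite (_ : Num.floor t = k) //; apply: Num.Theory.floor_def;
      rewrite t0 intrD.
  apply/subspace_continuousP => t; rewrite /= in_itv /= => /andP[t0 t1].
  move/subspace_continuousP : cg => /(_ (t - k%:~R)) cg.
  have {}cg := cg ltac:(by rewrite /= in_itv /=; apply/andP; split; lra).
  move=> V hV.
  have {hV} hV : \forall z \near t - k%:~R, `[0, 1]%classic z -> V (g z).
    exact: (cg V hV).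
  have : {for t, continuous (fun t : R => t - k%:~R)}.
    by apply: cvgB; [exact: cvg_id|exact: cvg_cst].
  move=> /(_ _ hV) {}hV.
  have {}hV : \forall z \near t, `[0, 1]%classic (z - k%:~R) -> V (g (z - k%:~R)).
    exact: hV.
  change (\forall z \near t, `[k%:~R, k%:~R + 1]%classic z -> V (g (z - k%:~R))).
  apply: filterS hV => z hz; rewrite /= in_itv /= => /andP[z0 z1].
  by apply: hz; rewrite /= in_itv /=; apply/andP; split; lra.
move=> t; have /andP[] := fl t.
rewrite le_eqVlt => /predU1P[e _|t0 t1].
  have et : t = (Num.floor t)%:~R by lra.
  apply: (continuous_within_glue (a := t - 1) (c := t + 1)).
  - by rewrite ltrBlDr ltrDl.
  - by rewrite ltrDl.
  - by have := on (Num.floor t - 1); rewrite intrB -et subrK.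
  - by have := on (Num.floor t); rewrite -et.
apply: (within_continuous_continuous _ (on (Num.floor t))); first lra.
by rewrite in_itv /=; apply/andP; split; lra.
Qed.

Section Theta.
Variable H : R -> plane R.
Hypothesis PH : periodic_param H.

Lemma param_inj T s t : T <= s < T + 1 -> T <= t < T + 1 -> H s = H t -> s = t.
Proof.
move=> /andP[s0 s1] /andP[t0 t1] /(PH.2 _ _)[k e].
have k0 : k = 0 by apply: int_lt1; rewrite -e; lra.
by move: e; rewrite k0 => /eqP; rewrite subr_eq0 => /eqP.
Qed.

Lemma param_neq T s t : T <= s -> s < t -> t < T + 1 -> H s <> H t.
Proof.
move=> Ts st tT /(param_inj (T := T)) e; move: (st); rewrite e ?ltxx //.
  by rewrite Ts (lt_trans st).
by rewrite tT andbT (le_trans Ts (ltW st)).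
Qed.

Lemma paramD1 s : H (s + 1) = H s.
Proof. by apply/PH.2; exists 1; rewrite addrAC subrr add0r. Qed.

Lemma param_window T x : range H x -> exists2 s, T <= s < T + 1 & H s = x.
Proof.
move=> [t _ <-]; exists (t - (Num.floor (t - T))%:~R).
  have := floor_itv (t - T); rewrite intrD => /andP[h1 h2].
  by apply/andP; split; lra.
by apply/PH.2; exists (- Num.floor (t - T)); rewrite mulrNz; ring.
Qed.

(** The coordinate along the curve cut open at [H T], with the default value [T] off the curve. *)
Definition theta T x : R := xget T [set s | T <= s < T + 1 /\ H s = x].

Lemma thetaP T x : range H x -> T <= theta T x < T + 1 /\ H (theta T x) = x.
Proof.
move=> /(param_window T)[s sT sx]; rewrite /theta.
by case: xgetP => [t -> []|/(_ s)] //= []; split.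
Qed.

Lemma theta_open T x : range H x -> x <> H T -> T < theta T x < T + 1.
Proof.
move=> /(thetaP T)[/andP[h1 h2] e] xT; rewrite h2 andbT lt_neqAle h1 andbT.
by apply/eqP => e'; apply: xT; rewrite -e -e'.
Qed.

Lemma thetaK T s : T <= s < T + 1 -> theta T (H s) = s.
Proof.
move=> sT; have [h1 h2] := @thetaP T (H s) ltac:(by exists s).
exact: (param_inj h1 sT h2).
Qed.

Lemma closed_param_segment a b : closed (H @` `[a, b]).
Proof.
apply: compact_closed; first exact: norm_hausdorff.
apply: continuous_compact; last exact: segment_compact.
by apply: continuous_subspaceT; exact: PH.1.
Qed.

(** The images of [[T, t0 - e]] and [[t0 + e, T + 1]] are compact and miss [x], so curve points near
    [x] have their parameter between. At the cut [H T] the coordinate jumps. *)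
Lemma theta_continuous T x e : range H x -> x <> H T -> 0 < e ->
  \forall y \near x, range H y -> `|theta T y - theta T x| < e.
Proof.
move=> rx xT e0; have /andP[h1 h2] := theta_open rx xT.
have [_ hx] := thetaP T rx.
set t0 := theta T x in h1 h2 hx *.
have near1 a b : T <= a -> b <= T + 1 -> b < t0 \/ t0 < a ->
    \forall y \near x, ~ (H @` `[a, b]) y.
  move=> aT bT ab; apply: open_nbhs_nbhs; split.
    by apply: closed_openC; exact: closed_param_segment.
  move=> [s]; rewrite /= in_itv /= => /andP[s0 s1] hs.
  have s1' : s <= T + 1 by lra.
  move: s1'; rewrite le_eqVlt => /predU1P[es|s1'].
    by apply: xT; rewrite -hs es paramD1.
  have : s = t0.
    by apply: (@param_inj T); rewrite ?hs ?hx //; apply/andP; split; lra.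
  by case: ab => ab; lra.
have n1 := @near1 T (t0 - e) (lexx _) ltac:(lra) ltac:(by left; lra).
have n2 := @near1 (t0 + e) (T + 1) ltac:(lra) (lexx _) ltac:(by right; lra).
near=> y => ry; have [/andP[k1 k2] hy] := thetaP T ry.
rewrite ltr_norml; apply/andP; split; rewrite ltNge; apply/negP => bad.
  have : ~ (H @` `[T, t0 - e]) y by near: y.
  by apply; exists (theta T y) => //=; rewrite in_itv /=; apply/andP; split; lra.
have : ~ (H @` `[t0 + e, T + 1]) y by near: y.
by apply; exists (theta T y) => //=; rewrite in_itv /=; apply/andP; split; lra.
Unshelve. all: by end_near.
Qed.

Lemma theta_within T (A : set R) (c : R -> plane R) :
  {within A, continuous c} ->
  (forall u, A u -> range H (c u) /\ c u <> H T) ->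
  {within A, continuous (fun u => theta T (c u))}.
Proof.
move=> /subspace_continuousP cc hc; apply/subspace_continuousP => u Au.
have [ru cT] := hc _ Au.
apply/cvgrPdist_lt => e e0; have nb := theta_continuous ru cT e0.
have := cc u Au _ nb; rewrite /within /= => hb.
have {}hb : \forall v \near u, A v -> range H (c v) ->
    `|theta T (c v) - theta T (c u)| < e by exact: hb.
rewrite near_withinE; apply: filterS hb => v hv Av.
by rewrite distrC; apply: hv => //; have [] := hc _ Av.
Qed.

End Theta.
End PeriodicParam.

(** * Paths on the curve and the direction in which they leave a point *)

Section Branches.
Variable R : realType.
Implicit Types (H c : R -> plane R) (s t u v T a : R) (psi : R -> R).

(* The path c runs along the curve from its base point H T, in the direction of
   increasing parameters. *)
Definition initial_branch H T c psi :=
  [/\ psi 0 = T, psi 1 < T + 1,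
      forall u v, 0 <= u -> u < v -> v <= 1 -> psi u < psi v,
      forall s, T <= s <= psi 1 -> exists2 u, 0 <= u <= 1 & psi u = s &
      forall u, 0 <= u <= 1 -> H (psi u) = c u].

Lemma within_segment0 c (V : set (plane R)) :
  {within `[0, 1], continuous c} -> nbhs (c 0) V ->
  exists2 u, 0 < u <= 1 & V (c u).
Proof.
move=> /subspace_continuousP /(_ 0) h hV.
have {}h : \forall u \near (0 : R), `[0, 1]%classic u -> V (c u).
  by apply: h hV; rewrite /= in_itv /= lexx ler01.
have [e /= e0 he] := (nbhs_ballP _ _).1 h.
exists (Num.min (e / 2) 1); first by rewrite lt_min ge_min lexx orbT ltr01 divr_gt0.
have m0 : 0 <= Num.min (e / 2) 1 by rewrite le_min ler01 divr_ge0 // ltW.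
have m1 : Num.min (e / 2) 1 < e.
  by rewrite gt_min ltr_pdivrMr // ltr_pMr // ltr1n.
apply: he; last by rewrite /= in_itv /= m0 ge_min lexx orbT.
by rewrite /ball /= sub0r normrN ger0_norm.
Qed.

Section Branch.
Variable H : R -> plane R.
Hypothesis PH : periodic_param H.
Variables (T : R) (c : R -> plane R).
Hypothesis sc : simple_curve_segment c.
Hypothesis rc : forall u, 0 <= u <= 1 -> range H (c u).

Section FromBase.
Hypothesis c0 : c 0 = H T.

Lemma branch_neq_base u : 0 < u <= 1 -> c u <> H T.
Proof.
move=> /andP[u0 u1]; rewrite -c0 => e.
have : u = 0 by apply: sc.2 => //; rewrite in_itv /= ?lexx ?ler01 ?(ltW u0).
by move=> eu; rewrite eu ltxx in u0.
Qed.

(** The path starts at the cut of [theta], where continuity fails, hence the interval open at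
    [0]. *)
Lemma theta_branch_mono :
  {in `]0, 1] &, {homo (fun u => theta H T (c u)) : u v / u < v}} \/
  {in `]0, 1] &, {homo (fun u => theta H T (c u)) : u v /~ u < v}}.
Proof.
apply: itv_continuous_inj_mono.
  apply: theta_within => //.
    apply: continuous_subspaceW sc.1 => u /=; rewrite !in_itv /=.
    by move=> /andP[/ltW -> ->].
  move=> u /=; rewrite in_itv /= => u01; split; last exact: branch_neq_base.
  by apply: rc; case/andP: u01 => /ltW -> ->.
move=> u v; rewrite !in_itv /= => /andP[u0 u1] /andP[v0 v1] e.
apply: sc.2; rewrite ?in_itv /= ?(ltW u0) ?(ltW v0) //.
have [_ <-] := thetaP PH T (rc (u := u) ltac:(by rewrite (ltW u0))).
have [_ <-] := thetaP PH T (rc (u := v) ltac:(by rewrite (ltW v0))).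
by rewrite e.
Qed.

Lemma initial_branch_of_homo :
  {in `]0, 1] &, {homo (fun u => theta H T (c u)) : u v / u < v}} ->
  initial_branch H T c (fun u => theta H T (c u)).
Proof.
move=> hm; have T1 : T <= T < T + 1 by rewrite lexx ltrDl ltr01.
have th u : 0 < u <= 1 -> T < theta H T (c u) < T + 1.
  move=> u01; apply: theta_open => //; last exact: branch_neq_base.
  by apply: rc; case/andP: u01 => /ltW -> ->.
split.
- by rewrite c0 thetaK.
- by have /andP[] := th 1 ltac:(by rewrite ltr01 lexx).
- move=> u v; rewrite le_eqVlt => /predU1P[<-|u0] uv v1.
    by rewrite c0 thetaK //; have /andP[] := th v ltac:(by rewrite uv).
  by apply: hm; rewrite ?in_itv /= ?u0 ?v1 ?(lt_trans u0 uv) // (le_trans (ltW uv)).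
- move=> s /andP[]; rewrite le_eqVlt => /predU1P[<-|Ts] s1.
    by exists 0; rewrite ?lexx ?ler01 // c0 thetaK.
  (* Otherwise every [c u] with [u > 0] would lie in the closed set [H[s, theta (c 1)]], which does
     not contain the limit [c 0 = H T]. *)
  have [u0 /andP[u00 u01] hu] : exists2 u0, 0 < u0 <= 1 & theta H T (c u0) <= s.
    apply: contrapT => hn.
    have [|u u01] := @within_segment0 c (~` (H @` `[s, theta H T (c 1)])) sc.1.
      apply: open_nbhs_nbhs; split.
        by apply: closed_openC; exact: closed_param_segment.
      move=> [t]; rewrite /= in_itv /= c0 => /andP[st t1] e.
      have /andP[h1 h2] := th 1 ltac:(by rewrite ltr01 lexx).
      have : t = T by apply: (param_inj PH (T := T)) e; apply/andP; split; lra.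
      by lra.
    apply; have [_ hcu] := thetaP PH T (rc (u := u) ltac:(by case/andP: u01 => /ltW -> ->)).
    exists (theta H T (c u)) => //; rewrite /= in_itv /=; apply/andP; split.
      by rewrite leNgt; apply/negP => /ltW hs; apply: hn; exists u.
    case/andP: u01 => u0 u1; have [-> //|un1] := eqVneq u 1.
    by apply/ltW/hm; rewrite ?in_itv /= ?u0 ?ltr01 ?lexx ?u1 // lt_neqAle un1.
  have cth : {within `[u0, 1], continuous (fun u => theta H T (c u))}.
    apply: theta_within => //.
      apply: continuous_subspaceW sc.1 => u /=; rewrite !in_itv /=.
      by move=> /andP[h1 ->]; rewrite (le_trans (ltW u00)).
    move=> u /=; rewrite in_itv /= => /andP[h1 h2].
    split; first by apply: rc; rewrite h2 andbT (le_trans (ltW u00)).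
    by apply: branch_neq_base; rewrite h2 andbT (lt_le_trans u00).
  have [|u] := IVT (v := s) u01 cth; first by rewrite ge_min le_max hu s1 orbT.
  rewrite in_itv /= => /andP[h1 h2] <-; exists u => //.
  by rewrite h2 andbT (le_trans (ltW u00)).
- by move=> u u01; have [_] := thetaP PH T (rc u01).
Qed.

End FromBase.

(** Away from the cut the coordinate of the path is continuous and injective, hence monotone; [min]
    and [max] appear because its direction is not known beforehand. *)
Lemma path_interval :
  (forall u, 0 <= u <= 1 -> c u <> H T) ->
  let b := theta H T (c 0) in let d := theta H T (c 1) in
  forall s, T <= s < T + 1 ->
  (exists2 u, 0 <= u <= 1 & c u = H s) <-> Num.min b d <= s <= Num.max b d.
Proof.
move=> cT b d s sT.
have cth : {within `[0, 1], continuous (fun u => theta H T (c u))}.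
  apply: theta_within => //; first exact: sc.1.
  by move=> u /=; rewrite in_itv /= => u01; split; [exact: rc|exact: cT].
have ith : {in `[0, 1] &, injective (fun u => theta H T (c u))}.
  move=> u v u01 v01 e; apply: sc.2 => //; rewrite in_itv /= in u01 v01.
  have [_ <-] := thetaP PH T (rc u01); have [_ <-] := thetaP PH T (rc v01).
  by rewrite e.
split.
  move=> [u /andP[u0 u1] cu].
  have es : theta H T (c u) = s by rewrite cu thetaK.
  have i0 : (0 : R) \in `[0, 1] by rewrite in_itv /= lexx ler01.
  have i1 : (1 : R) \in `[0, 1] by rewrite in_itv /= lexx ler01.
  have iu : u \in `[0, 1] by rewrite in_itv /= u0 u1.
  have [hm|hm] := itv_continuous_inj_mono cth ith; rewrite ge_min le_max -es.
    have h1 : b <= theta H T (c u).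
      move: u0; rewrite le_eqVlt => /predU1P[<- //|u0]; exact/ltW/hm.
    have h2 : theta H T (c u) <= d.
      move: u1; rewrite le_eqVlt => /predU1P[-> //|u1]; exact/ltW/hm.
    by rewrite h1 h2 orbT.
  have h1 : theta H T (c u) <= b.
    move: u0; rewrite le_eqVlt => /predU1P[<- //|u0]; exact/ltW/hm.
  have h2 : d <= theta H T (c u).
    move: u1; rewrite le_eqVlt => /predU1P[-> //|u1]; exact/ltW/hm.
  by rewrite h1 h2 orbT.
move=> /(IVT ler01 cth)[u]; rewrite in_itv /= => u01 <-; exists u => //.
by have [_ ->] := thetaP PH T (rc u01).
Qed.

End Branch.

Lemma branch H T c : periodic_param H -> simple_curve_segment c ->
  (forall u, 0 <= u <= 1 -> range H (c u)) -> c 0 = H T ->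
  (exists psi, initial_branch H T c psi) \/
  (exists psi, initial_branch (fun s => H (- s)) (- (T + 1)) c psi).
Proof.
move=> PH sc rc c0; have [hm|hm] := theta_branch_mono PH sc rc c0.
  by left; eexists; exact: initial_branch_of_homo hm.
(* The path starts at the end [T + 1] of the window and runs down. For the reversed curve this is
   the origin [- (T + 1)] of a window. *)
right; pose H' s := H (- s); have PH' : periodic_param H' := periodic_param_opp PH.
have rc' u : 0 <= u <= 1 -> range H' (c u).
  by move=> /rc[s _ <-]; exists (- s) => //; rewrite /H' opprK.
have c0' : c 0 = H' (- (T + 1)) by rewrite /H' opprK paramD1.
exists (fun u => theta H' (- (T + 1)) (c u)); apply: initial_branch_of_homo => //.
have e u : 0 < u <= 1 -> theta H' (- (T + 1)) (c u) = - theta H T (c u).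
  move=> u01; have u01' : 0 <= u <= 1 by case/andP: u01 => /ltW -> ->.
  have /andP[h1 h2] := theta_open PH (rc u u01') (branch_neq_base sc c0 u01).
  have [_ h3] := thetaP PH T (rc u u01').
  rewrite -[in LHS]h3 -[in LHS](opprK (theta H T (c u))).
  by rewrite -/(H' _) thetaK //; apply/andP; split; lra.
move=> u v; rewrite !in_itv /= => u01 v01 uv; rewrite !e // ltrN2.
by apply: hm; rewrite ?in_itv.
Qed.

Lemma first_level (f : R -> R) D T s : continuous f -> T <= s -> D <= f s ->
  exists t0, [/\ T <= t0, t0 <= s, D <= f t0 & forall t, T <= t -> t < t0 -> f t < D].
Proof.
move=> cf Ts fs; pose E : set R := [set t | T <= t /\ D <= f t].
have Es : E s by [].
have hE : has_inf E by split; [exists s|exists T => t []].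
exists (inf E); split.
- by apply: lb_le_inf; [exists s|move=> t []].
- by apply: ge_inf => //; exists T => t [].
- rewrite leNgt; apply/negP => lt.
  have [e /= e0 he] : exists2 e : R, 0 < e & forall t, `|inf E - t| < e -> f t < D.
    have /cvgrPdist_lt /(_ (D - f (inf E))) := cf (inf E).
    rewrite subr_gt0 => /(_ lt) /nbhs_ballP[e /= e0 he]; exists e => // t ht.
    have := he t ht; rewrite /= ltr_norml => /andP[h1 h2]; lra.
  have [t [Tt ft] te] := inf_adherent e0 hE.
  have it : inf E <= t by apply: ge_inf => //; exists T => ? [].
  have : f t < D by apply: he; rewrite ler0_norm; lra.
  by lra.
- move=> t Tt; apply: contraTT; rewrite -!leNgt => ft.
  by apply: ge_inf => //; exists T => ? [].
Qed.

(* At the first parameter where the distance to p reaches that of c 1, the two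
   branches meet at a point fixed by the rotation. *)
Lemma rotated_branches_not_aligned H T c a psi psi' : periodic_param H ->
  a != 0 -> `|a| < 2 * pi -> initial_branch H T c psi ->
  initial_branch H T (fun u => rotation a (H T) (c u)) psi' -> False.
Proof.
move=> PH a0 a2 [p0 p1 pm ps pH] [q0 q1 qm qs qH].
pose f s := sqdist (H T) (H s); pose D := f (psi 1).
have cf : continuous f.
  move=> s; apply: (@continuous_comp _ _ _ H (sqdist (H T))); first exact: PH.1.
  exact: continuous_sqdist.
have fq u : 0 <= u <= 1 -> f (psi' u) = f (psi u).
  by move=> u01; rewrite /f qH // pH // sqdist_rotation_center.
have i1 : 0 <= (1 : R) <= 1 by rewrite lexx ler01.
have Tp u : 0 <= u <= 1 -> T <= psi u.
  move=> /andP[]; rewrite le_eqVlt => /predU1P[<-|u0 u1]; first by rewrite p0.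
  by rewrite -p0 ltW // pm.
have Tq u : 0 <= u <= 1 -> T <= psi' u.
  move=> /andP[]; rewrite le_eqVlt => /predU1P[<-|u0 u1]; first by rewrite q0.
  by rewrite -q0 ltW // qm.
have [t0 [Tt0 t01 Dt0 ht0]] := first_level cf (Tp 1 i1) (lexx D).
have t01' : t0 <= psi' 1.
  rewrite leNgt; apply/negP => /(ht0 _ (Tq 1 i1)); rewrite fq // ltxx //.
have [u u01 eu] := ps t0 ltac:(by rewrite Tt0).
have [v v01 ev] := qs t0 ltac:(by rewrite Tt0).
have uv : u = v.
  have [uv|vu|//] := ltgtP u v; exfalso.
    have : f (psi' u) < D.
      by apply: ht0; [exact: Tq|rewrite -ev qm //; [case/andP: u01|case/andP: v01]].
    by rewrite fq // eu ltNge Dt0.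
  have : f (psi v) < D.
    by apply: ht0; [exact: Tp|rewrite -eu pm //; [case/andP: v01|case/andP: u01]].
  by rewrite -fq // ev ltNge Dt0.
have D0 : 0 < D.
  apply: sqdist_gt0 => /(param_inj PH (T := T)) e.
  have : psi 0 < psi 1 by apply: pm; rewrite ?lexx ?ltr01.
  by rewrite -e ?p0 ?ltxx ?lexx ?ltrDl ?ltr01 // p1 andbT Tp.
have cp : c u <> H T.
  by move=> e; move: Dt0; rewrite /f -eu pH // e sqdist_xx leNgt D0.
have := qH _ v01; rewrite ev -eu -uv pH // => /esym /(rotation_fixed cp a2) e.
by rewrite e eqxx in a0.
Qed.

End Branches.

(** * Decomposition of the boundary when the centre ends the segment *)

Section RadialForm.
Variable R : realType.
Implicit Types (H c : R -> plane R) (s t u v T a b d : R) (p q x : plane R).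
Implicit Types (psi : R -> R).

(* The curve H, based at p = H T, consists of a branch H[T, b], an arc H[b, c]
   of signed angle d centred at p, and the branch H[c, T + 1], the image of the
   first one under the rotation by d; psi u and psi' u correspond to each other
   under this rotation. *)
Record radial_form H p T b (c : R) d psi psi' : Prop := RadialForm {
  rf_Tb : T < b;
  rf_bc : b < c;
  rf_cT : c < T + 1;
  rf_base : H T = p;
  rf_angle0 : d != 0;
  rf_angle : `|d| < 2 * pi;
  rf_arc : forall x, (exists2 s, b <= s <= c & H s = x) <->
    (exists2 v, 0 <= v <= 1 & rotation (v * d) p (H b) = x);
  rf_end : H c = rotation d p (H b);
  rf_psi0 : psi 0 = T;
  rf_psi1 : psi 1 = b;
  rf_psi'0 : psi' 0 = T + 1;
  rf_psi'1 : psi' 1 = c;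
  rf_incr : forall u v, 0 <= u -> u < v -> v <= 1 -> psi u < psi v;
  rf_decr : forall u v, 0 <= u -> u < v -> v <= 1 -> psi' v < psi' u;
  rf_onto : forall s, T <= s <= b -> exists2 u, 0 <= u <= 1 & psi u = s;
  rf_onto' : forall s, c <= s <= T + 1 -> exists2 u, 0 <= u <= 1 & psi' u = s;
  rf_rot : forall u, 0 <= u <= 1 -> H (psi' u) = rotation d p (H (psi u)) }.

(** Reversal exchanges the two branches and negates the signed angle; thus one-sided statements
    about the form need only one proof. *)
Lemma radial_form_opp H p T b (c : R) d psi psi' :
  periodic_param H -> radial_form H p T b c d psi psi' ->
  radial_form (fun s => H (- s)) p (- (T + 1)) (- c) (- b) (- d)
    (fun u => - psi' u) (fun u => - psi u).
Proof.
move=> PH [Tb bc cT base a0 a2 arc e p0 p1 q0 q1 inc dec ont ont' rt].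
split=> //; rewrite ?oppr_eq0 ?normrN ?ltrN2 ?opprK ?p0 ?p1 ?q0 ?q1 ?paramD1 //.
- by lra.
- move=> x; split.
    move=> [s sbc hx]; have /arc[v /andP[v0 v1] <-] :
        exists2 s, b <= s <= c & H s = x.
      by exists (- s) => //; apply/andP; split; lra.
    exists (1 - v); first by apply/andP; split; lra.
    by rewrite e rotationD; congr rotation; ring.
  move=> [v /andP[v0 v1] <-].
  have /arc[s /andP[s0 s1] hs] : exists2 w, 0 <= w <= 1 &
      rotation (w * d) p (H b) = rotation (v * - d) p (H c).
    exists (1 - v); first by apply/andP; split; lra.
    by rewrite e rotationD; congr rotation; ring.
  by exists (- s); rewrite ?opprK //; apply/andP; split; lra.
- by rewrite e rotationK.
- by lra.
- by move=> u v u0 uv v1; rewrite ltrN2; exact: dec.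
- by move=> u v u0 uv v1; rewrite ltrN2; exact: inc.
- move=> s /andP[s0 s1]; have [|u u01 eu] := ont' (- s).
    by apply/andP; split; lra.
  by exists u; rewrite ?eu ?opprK.
- move=> s /andP[s0 s1]; have [|u u01 eu] := ont (- s).
    by apply/andP; split; lra.
  by exists u; rewrite ?eu ?opprK.
- by move=> u u01; rewrite !opprK rt // rotationK.
Qed.

Lemma param_neq_base H T s :
  periodic_param H -> T < s < T + 1 -> H s <> H T.
Proof.
move=> PH /andP[s0 s1] /(param_inj PH (T := T)) e.
by move: (s0); rewrite e ?ltxx // ?(ltW s0) ?lexx ?ltrDl ?ltr01.
Qed.

(** The swept arc is a path avoiding its centre [H T], so [path_interval] applies to it. Which end
    comes first is still open at this stage. *)
Lemma swept_interval H T q b (c : R) a : periodic_param H ->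
  T < b < T + 1 -> T < c < T + 1 -> H b = q -> H c = rotation a (H T) q ->
  0 < a < 2 * pi -> swept_arc (H T) a q `<=` range H ->
  forall s, T <= s < T + 1 ->
  (exists2 w, 0 <= w <= a & rotation w (H T) q = H s) <->
  Num.min b c <= s <= Num.max b c.
Proof.
move=> PH /andP[b0 b1] /andP[c0 c1] hb hc /andP[a0 a2] sw s sT.
have qT : q <> H T.
  by rewrite -hb; apply: param_neq_base PH _; rewrite b0.
pose g v := rotation (v * a) (H T) q.
have va v : 0 <= v <= 1 -> 0 <= v * a <= a.
  by move=> /andP[v0 v1]; rewrite mulr_ge0 ?(ltW a0) //= ger_pMl.
have sg : simple_curve_segment g.
  split.
    apply: continuous_subspaceT => v.
    apply: (@continuous_comp _ _ _ (fun v => v * a)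
      (fun u => rotation u (H T) q)).
      exact: mulrr_continuous.
    exact: continuous_rotation_angle.
  move=> u v; rewrite !in_itv /= => /va/andP[u0 u1] /va/andP[v0 v1].
  move=> /(rotation_inj_angle qT) e; apply: (mulIf (lt0r_neq0 a0)); apply: e.
  by rewrite ltr_norml; apply/andP; split; lra.
have rg v : 0 <= v <= 1 -> range H (g v).
  by move=> /va v01; apply: sw; exists (v * a).
have gT v : 0 <= v <= 1 -> g v <> H T by move=> _; apply/rotation_neq.
have := path_interval PH sg rg gT sT.
rewrite /g mul0r mul1r rotation0 -hc -hb !thetaK //; try (by apply/andP; split; lra).
move=> <-; split.
  move=> [w /andP[w0 w1] e]; exists (w / a); last by rewrite divfK // lt0r_neq0.
  by rewrite divr_ge0 ?(ltW a0) //= ler_pdivrMr // mul1r.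
by move=> [v /va v01 e]; exists (v * a).
Qed.

(** The branches leave the centre in opposite directions; what has to be shown is [b < e], that they
    stop before meeting. The swept arc then fills the gap. *)
Lemma radial_form_aligned H T c a psi psi1 : periodic_param H ->
  0 < a < 2 * pi -> swept_arc (H T) a (c 1) `<=` range H ->
  initial_branch H T c psi ->
  initial_branch (fun s => H (- s)) (- (T + 1))
    (fun u => rotation a (H T) (c u)) psi1 ->
  radial_form H (H T) T (psi 1) (- psi1 1) a psi (fun u => - psi1 u).
Proof.
move=> PH aa sw [p0 p1 pm ps pH] [q0 q1 qm qs qH].
have /andP[a0 a2] := aa.
have i1 : 0 <= (1 : R) <= 1 by rewrite lexx ler01.
have Tp : T < psi 1 by rewrite -p0 pm // ?ltr01.
have Tq : - (T + 1) < psi1 1 by rewrite -q0 qm // ?ltr01.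
set b := psi 1 in p1 ps Tp *; set e := - psi1 1.
have Te : T < e < T + 1 by rewrite /e; apply/andP; split; lra.
have Tb : T < b < T + 1 by rewrite Tp.
have hb : H b = c 1 by exact: pH.
have he : H e = rotation a (H T) (c 1) by exact: qH.
have cT : c 1 <> H T.
  by rewrite -hb; exact: param_neq_base PH _.
have I := swept_interval PH Tb Te hb he aa sw.
have qs' s : e <= s <= T + 1 -> exists2 u, 0 <= u <= 1 & - psi1 u = s.
  move=> /andP[s0 s1]; have [|u u01 eu] := qs (- s).
    by rewrite /e in s0; apply/andP; split; lra.
  by exists u => //; rewrite eu opprK.
have qle u v : 0 <= u -> u <= v -> v <= 1 -> - psi1 v <= - psi1 u.
  move=> u0; rewrite le_eqVlt => /predU1P[-> //|uv] v1.
  by rewrite lerN2 ltW // qm.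
have ple u v : 0 <= u -> u <= v -> v <= 1 -> psi u <= psi v.
  by move=> u0; rewrite le_eqVlt => /predU1P[-> //|uv] v1; rewrite ltW // pm.
(* If [e < b], the overlap [[e, b]] is the swept arc and the final stretches of both branches cover
   it. Depending on which stretch is longer, the rotation by [a] sends a point at angle [w] to a
   point of the arc, or sends some point of the arc to angle [a - w]; both give an angle outside
   [[0, a]]. *)
have be : b < e.
  rewrite ltNge; apply/negP; rewrite le_eqVlt => /predU1P[eb|eb].
    have : rotation a (H T) (c 1) = c 1 by rewrite -he -hb eb.
    move=> /(rotation_fixed cT) E; move: a0; rewrite E ?ltxx //.
    by rewrite ltr_norml; apply/andP; split; lra.
  have [u2 /andP[u20 u21] hu2] := ps e ltac:(by apply/andP; split; lra).
  have [u1 /andP[u10 u11] hu1] := qs' b ltac:(by apply/andP; split; lra).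
  have Is s : e <= s <= b -> exists2 w, 0 <= w <= a & rotation w (H T) (c 1) = H s.
    move=> /andP[s0 s1]; apply/I; first by apply/andP; split; lra.
    by rewrite (min_idPr (ltW eb)) (max_idPl (ltW eb)) s0.
  have Ia w : 0 <= w <= a -> exists2 s, e <= s <= b & H s = rotation w (H T) (c 1).
    move=> w0a; have [|sT sh] := @thetaP _ _ PH T (rotation w (H T) (c 1)).
      by apply: sw; exists w; rewrite //= in_itv.
    exists (theta H T (rotation w (H T) (c 1))) => //.
    have : exists2 w', 0 <= w' <= a & rotation w' (H T) (c 1) =
      H (theta H T (rotation w (H T) (c 1))) by exists w.
    by move=> /(I _ sT); rewrite (min_idPr (ltW eb)) (max_idPl (ltW eb)).
  (* Positive, at most [a] to stay on the arc, and with [a + w < 2 * pi] so that equal points have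
     equal angles. *)
  pose w := Num.min a ((2 * pi - a) / 2).
  have w0 : 0 < w by rewrite lt_min a0 /= divr_gt0 // subr_gt0.
  have wa : w <= a by rewrite ge_min lexx.
  have w2 : w <= (2 * pi - a) / 2 by rewrite ge_min lexx orbT.
  have [u12|u21'] := leP u1 u2.
    have [s /andP[s0 s1] hs] := Ia w ltac:(by rewrite wa ltW).
    have [u /andP[u0 u1'] hu] := ps s ltac:(by apply/andP; split; lra).
    have u2u : u2 <= u.
      rewrite leNgt; apply/negP => uu2.
      by have := pm u u2 u0 uu2 u21; rewrite hu hu2; lra.
    have h1 : - psi1 u <= b by rewrite -hu1; apply: qle => //; lra.
    have h2 : e <= - psi1 u by apply: qle.
    have [w' /andP[w'0 w'a]] := Is (- psi1 u) ltac:(by rewrite h1 h2).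
    rewrite qH ?u0 // -(pH u) ?u0 // hu hs rotationD => /(rotation_inj_angle cT) E.
    have : w' = a + w by apply: E; rewrite ltr_norml; apply/andP; split; lra.
    by lra.
  have [s /andP[s0 s1] hs] := Ia (a - w) ltac:(by apply/andP; split; lra).
  have [u /andP[u0 u1'] hu] := qs' s ltac:(by apply/andP; split; lra).
  have u1u : u1 <= u.
    rewrite leNgt; apply/negP => uu1.
    by have := qm u u1 u0 uu1 u11; lra.
  have h1 : e <= psi u by rewrite -hu2; apply: ple => //; lra.
  have h2 : psi u <= b by apply: ple.
  have [w' /andP[w'0 w'a]] := Is (psi u) ltac:(by rewrite h1 h2).
  have : rotation a (H T) (H (psi u)) = rotation (a - w) (H T) (c 1).
    by rewrite pH ?u0 // -(qH u) ?u0 // hu.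
  move=> h3 h4; move: h3; rewrite -h4 rotationD => /(rotation_inj_angle cT) E.
  have : a + w' = a - w by apply: E; rewrite ltr_norml; apply/andP; split; lra.
  by lra.
split=> //.
- by case/andP: Te.
- by rewrite lt0r_neq0.
- by rewrite gtr0_norm.
- move=> x; split.
    move=> [s /andP[s0 s1] <-].
    have /I[] : Num.min b e <= s <= Num.max b e.
    - by rewrite (min_idPl (ltW be)) (max_idPr (ltW be)) s0.
    - by apply/andP; split; lra.
    move=> w /andP[w0 wa] <-; exists (w / a); rewrite ?hb ?divfK ?lt0r_neq0 //.
    by rewrite divr_ge0 ?(ltW a0) //= ler_pdivrMr // mul1r.
  move=> [v /andP[v0 v1]]; rewrite hb => <-.
  have wa : 0 <= v * a <= a by rewrite mulr_ge0 ?(ltW a0) //= ger_pMl.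
  have [|sT sh] := @thetaP _ _ PH T (rotation (v * a) (H T) (c 1)).
    by apply: sw; exists (v * a).
  exists (theta H T (rotation (v * a) (H T) (c 1))) => //.
  have : exists2 w', 0 <= w' <= a & rotation w' (H T) (c 1) =
    H (theta H T (rotation (v * a) (H T) (c 1))) by exists (v * a).
  by move=> /(I _ sT); rewrite (min_idPl (ltW be)) (max_idPr (ltW be)).
- by rewrite he hb.
- by rewrite q0 opprK.
- by move=> u v u0 uv v1; rewrite ltrN2 qm.
- by move=> u u01; rewrite qH // pH.
Qed.

Lemma simple_curve_segment_rotation c a p :
  simple_curve_segment c -> simple_curve_segment (fun u => rotation a p (c u)).
Proof.
move=> [cc ic]; split; last first.
  by move=> s t s01 t01 /(can_inj (rotationK a p)); exact: ic.
move=> s; apply: (@continuous_comp _ _ _ (c : subspace _ -> _) (rotation a p)).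
  exact: cc.
exact: continuous_rotation.
Qed.

Lemma opp_opp_param H : (fun s => H (- - s)) = H.
Proof. by apply/funext => s; rewrite opprK. Qed.

(** A branch and its image cannot start in the same direction; the two remaining cases differ by a
    reversal of the curve. *)
Lemma radial_form_endpoint H T c a : periodic_param H ->
  0 < a < 2 * pi -> simple_curve_segment c -> c 0 = H T ->
  (forall u, 0 <= u <= 1 -> range H (c u)) ->
  (forall u, 0 <= u <= 1 -> range H (rotation a (H T) (c u))) ->
  swept_arc (H T) a (c 1) `<=` range H ->
  exists b e d psi psi', radial_form H (H T) T b e d psi psi'.
Proof.
move=> PH aa sc c0 rc rc' sw.
have sc' := simple_curve_segment_rotation a (H T) sc.
have c0' : rotation a (H T) (c 0) = H T by rewrite c0 rotation_center.
have a0 : a != 0 by case/andP: aa => /lt0r_neq0.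
have a2 : `|a| < 2 * pi by case/andP: aa => a1 a2; rewrite gtr0_norm.
have PH' := periodic_param_opp PH.
have bT : H (- (- (T + 1))) = H T by rewrite opprK paramD1.
have [[psi hp]|[psi hp]] := branch PH sc rc c0;
  have [[psi' hq]|[psi' hq]] := branch PH sc' rc' c0'.
- by have := rotated_branches_not_aligned PH a0 a2 hp hq.
- do 5 eexists; exact: radial_form_aligned hp hq.
- have : radial_form (fun s => H (- s)) (H (- (- (T + 1)))) (- (T + 1)) (psi 1)
      (- psi' 1) a psi (fun u => - psi' u).
    apply: (@radial_form_aligned (fun s => H (- s)) (- (T + 1)) c) => //.
    + rewrite bT => x /sw[s _ <-]; exists (- s) => //; by rewrite opprK.
    + by rewrite opp_opp_param bT (_ : - (- (T + 1) + 1) = T) //; ring.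
  rewrite bT => /(radial_form_opp PH'); rewrite opp_opp_param.
  rewrite (_ : - (- (T + 1) + 1) = T) //; last by ring.
  by move=> h; do 5 eexists; exact: h.
- have := @rotated_branches_not_aligned _ (fun s => H (- s)) (- (T + 1)) c a psi psi'.
  by rewrite bT => h; have := h PH' a0 a2 hp hq.
Qed.

End RadialForm.

(** * The centre is not an inner point of the segment *)

Section Center.
Variable R : realType.
Implicit Types (H c : R -> plane R) (s t u v T a b d : R) (p q x : plane R).
Implicit Types (psi : R -> R).

(** Two paths leaving [H T] in the same direction, or running past each other from opposite sides,
    would share a point other than their origin. *)
Lemma branches_opposite H T c c' psi : periodic_param H ->
  simple_curve_segment c' -> c' 0 = H T ->
  (forall u, 0 <= u <= 1 -> range H (c' u)) ->
  (forall u v, 0 < u <= 1 -> 0 < v <= 1 -> c u <> c' v) ->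
  initial_branch H T c psi ->
  exists2 psi', initial_branch (fun s => H (- s)) (- (T + 1)) c' psi' &
    psi 1 < - psi' 1.
Proof.
move=> PH sc c0 rc dj [p0 p1 pm ps pH].
have pos u : 0 <= u <= 1 -> T < psi u -> 0 < u <= 1.
  move=> /andP[]; rewrite le_eqVlt => /predU1P[<-|-> -> //].
  by rewrite p0 ltxx.
have Tp : T < psi 1 by rewrite -p0 pm // ?ltr01.
have [[psi' [q0 q1 qm qs qH]]|[psi' hb]] := branch PH sc rc c0.
  have Tq : T < psi' 1 by rewrite -q0 qm // ?ltr01.
  pose s := Num.min (psi 1) (psi' 1).
  have Ts : T < s by rewrite lt_min Tp Tq.
  have [|u u01 eu] := ps s; first by rewrite ltW //= ge_min lexx.
  have [|v v01 ev] := qs s; first by rewrite ltW //= ge_min lexx orbT.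
  exfalso; apply: (dj u v); [by apply: pos; rewrite ?eu| |].
    move: v01 => /andP[]; rewrite le_eqVlt => /predU1P[v0|-> -> //].
    by move: Ts; rewrite -ev -v0 q0 ltxx.
  by rewrite -pH // -qH // eu ev.
exists psi' => //; have [q0 q1 qm qs qH] := hb.
rewrite ltNge; apply/negP => le.
have [|v v01 ev] := qs (- psi 1); first by apply/andP; split; lra.
apply: (dj 1 v); first by rewrite ltr01 lexx.
  move: v01 => /andP[]; rewrite le_eqVlt => /predU1P[v0|-> -> //].
  by move: ev; rewrite -v0 q0; lra.
by rewrite -qH // -pH ?lexx ?ler01 // ev opprK.
Qed.

(** Each half of the segment leaves [H T] on the same side as the image of the other half. The order
    of the four ends then forces both swept arcs to occupy the same interval with exchanged ends;
    [a] would be [pi], and two complementary half-circles would coincide. *)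
Lemma interior_center_aligned H T c c' a psi : periodic_param H ->
  0 < a < 2 * pi -> simple_curve_segment c -> simple_curve_segment c' ->
  c 0 = H T -> c' 0 = H T ->
  (forall u, 0 <= u <= 1 -> range H (c u)) ->
  (forall u, 0 <= u <= 1 -> range H (c' u)) ->
  (forall u, 0 <= u <= 1 -> range H (rotation a (H T) (c u))) ->
  (forall u, 0 <= u <= 1 -> range H (rotation a (H T) (c' u))) ->
  (forall u v, 0 < u <= 1 -> 0 < v <= 1 -> c u <> c' v) ->
  swept_arc (H T) a (c 1) `<=` range H ->
  swept_arc (H T) a (c' 1) `<=` range H ->
  initial_branch H T c psi -> False.
Proof.
move=> PH aa sc sc' c0 c'0 rc rc' rr rr' dj sw sw' hb.
have /andP[a_gt0 a_lt] := aa.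
have a0 : a != 0 by rewrite lt0r_neq0.
have a2 : `|a| < 2 * pi by rewrite gtr0_norm.
have PH' := periodic_param_opp PH.
have bT : H (- (- (T + 1))) = H T by rewrite opprK paramD1.
have src := simple_curve_segment_rotation a (H T) sc.
have src' := simple_curve_segment_rotation a (H T) sc'.
have rc0 : rotation a (H T) (c 0) = H T by rewrite c0 rotation_center.
have rc'0 : rotation a (H T) (c' 0) = H T by rewrite c'0 rotation_center.
have [psi' hb' lt1] := branches_opposite PH sc' c'0 rc' dj hb.
have [[phi' hr']|[phi' hr']] := branch PH src' rr' rc'0; last first.
  have := @rotated_branches_not_aligned _ (fun s => H (- s)) (- (T + 1)) c' a psi' phi'.
  by rewrite bT => h; exact: (h PH' a0 a2 hb' hr').
have djr u v : 0 < u <= 1 -> 0 < v <= 1 ->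
    rotation a (H T) (c' u) <> rotation a (H T) (c v).
  by move=> u01 v01 /(can_inj (rotationK a _)) /esym; exact: dj.
have [phi hr lt2] := branches_opposite PH src rc0 rr djr hr'.
have T01 : 0 <= (1 : R) <= 1 by rewrite lexx ler01.
set b0 := psi 1 in lt1; set b1 := - psi' 1 in lt1.
set d1 := phi' 1 in lt2; set d0 := - phi 1 in lt2.
have hb0 : H b0 = c 1 by case: hb => _ _ _ _; exact.
have hb1 : H b1 = c' 1 by case: hb' => _ _ _ _; exact.
have hd0 : H d0 = rotation a (H T) (c 1) by case: hr => _ _ _ _; exact.
have hd1 : H d1 = rotation a (H T) (c' 1) by case: hr' => _ _ _ _; exact.
have Tb0 : T < b0 < T + 1.
  by case: hb => p0 p1 pm _ _; rewrite p1 andbT -p0 pm // ?ltr01.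
have Td1 : T < d1 < T + 1.
  by case: hr' => p0 p1 pm _ _; rewrite p1 andbT -p0 pm // ?ltr01.
have Tb1 : T < b1 < T + 1.
  case: hb' => p0 p1 pm _ _.
  have : psi' 0 < psi' 1 by rewrite pm // ?ltr01.
  by rewrite p0 /b1 => h; apply/andP; split; lra.
have Td0 : T < d0 < T + 1.
  case: hr => p0 p1 pm _ _.
  have : phi 0 < phi 1 by rewrite pm // ?ltr01.
  by rewrite p0 /d0 => h; apply/andP; split; lra.
have I0 := swept_interval PH Tb0 Td0 hb0 hd0 aa sw.
have I1 := swept_interval PH Tb1 Td1 hb1 hd1 aa sw'.
have cT : c 1 <> H T by rewrite -hb0; exact: param_neq_base.
have c'T : c' 1 <> H T by rewrite -hb1; exact: param_neq_base.
have nb0 : b0 <> d0.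
  move=> e; have := hd0; rewrite -e hb0 => /esym/(rotation_fixed cT a2) ea.
  by rewrite ea eqxx in a0.
have nb1 : b1 <> d1.
  move=> e; have := hd1; rewrite -e hb1 => /esym/(rotation_fixed c'T a2) ea.
  by rewrite ea eqxx in a0.
have F (q q' : plane R) s r : H s = q' -> H r = rotation a (H T) q ->
    (exists2 w, 0 <= w <= a & rotation w (H T) q = H s) ->
    (exists2 w, 0 <= w <= a & rotation w (H T) q' = H r).
  move=> hs hr0 [w /andP[w0 wa] e]; exists (a - w).
    by apply/andP; split; lra.
  by rewrite -hs -e hr0 rotationD subrK.
have G (q q' : plane R) s r : H s = q' -> H r = rotation a (H T) q ->
    (exists2 w, 0 <= w <= a & rotation w (H T) q' = H r) ->
    (exists2 w, 0 <= w <= a & rotation w (H T) q = H s).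
  move=> hs hr0 [w /andP[w0 wa] e]; exists (a - w).
    by apply/andP; split; lra.
  apply: (can_inj (rotationK w (H T))).
  by rewrite rotationD addrC subrK -hr0 -e hs.
have tw s : T < s < T + 1 -> T <= s < T + 1 by move=> /andP[/ltW -> ->].
(* If [c' 1] is at angle [w] on the arc from [c 1], then the image of [c 1] is at angle [a - w] on
   the arc from [c' 1], and conversely. *)
have E1 : (Num.min b0 d0 <= b1 <= Num.max b0 d0) <->
    (Num.min b1 d1 <= d0 <= Num.max b1 d1).
  rewrite -(I0 _ (tw _ Tb1)) -(I1 _ (tw _ Td0)).
  by split; [exact: F hb1 hd0|exact: G hb1 hd0].
have E2 : (Num.min b1 d1 <= b0 <= Num.max b1 d1) <->
    (Num.min b0 d0 <= d1 <= Num.max b0 d0).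
  rewrite -(I1 _ (tw _ Tb0)) -(I0 _ (tw _ Td1)).
  by split; [exact: F hb0 hd1|exact: G hb0 hd1].
(* Pure order: with [b0 < b1] and [d1 < d0], the two equivalences rule out every other position. *)
have [e01 e10] : b1 = d0 /\ b0 = d1.
  clear -E1 E2 nb0 nb1 lt1 lt2.
  have [h0|h0|//] := ltgtP b0 d0; have [h1|h1|//] := ltgtP b1 d1;
    rewrite ?(min_idPl (ltW h0)) ?(max_idPr (ltW h0)) ?(min_idPr (ltW h0))
      ?(max_idPl (ltW h0)) ?(min_idPl (ltW h1)) ?(max_idPr (ltW h1))
      ?(min_idPr (ltW h1)) ?(max_idPl (ltW h1)) in E1 E2.
  - have /E1/andP[? ?] : b0 <= b1 <= d0 by apply/andP; split; lra.
    by lra.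
  - split.
      have [h|h|//] := ltgtP b1 d0.
        have /E1/andP[? ?] : b0 <= b1 <= d0 by apply/andP; split; lra.
        by lra.
      have /E1/andP[? ?] : d1 <= d0 <= b1 by apply/andP; split; lra.
      by lra.
    have [h|h|//] := ltgtP b0 d1.
      have /E2/andP[? ?] : b0 <= d1 <= d0 by apply/andP; split; lra.
      by lra.
    have /E2/andP[? ?] : d1 <= b0 <= b1 by apply/andP; split; lra.
    by lra.
  - by lra.
  - have /E1/andP[? ?] : d1 <= d0 <= b1 by apply/andP; split; lra.
    by lra.
(* The midpoint of one half-circle is not on the other. *)
have a12 : 0 <= a / 2 <= a by apply/andP; split; lra.
have [|sT sh] := @thetaP _ _ PH T (rotation (a / 2) (H T) (c 1)).
  by apply: sw; exists (a / 2).
have /(I0 _ sT) : exists2 w, 0 <= w <= a & rotation w (H T) (c 1) =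
    H (theta H T (rotation (a / 2) (H T) (c 1))) by exists (a / 2).
rewrite -e01 e10 minC maxC => /(I1 _ sT)[w /andP[w0 wa]].
rewrite sh -hb1 e01 hd0 rotationD => /(rotation_inj_angle cT) E.
have pi0 := pi_gt0 R.
have faa : rotation (a + a) (H T) (c 1) = c 1.
  by rewrite -rotationD -hd0 -e01 hb1 -hd1 -e10.
have a_pi := rotation_double cT aa faa.
have : w + a = a / 2.
  by apply: E; rewrite ltr_norml; apply/andP; split; lra.
by lra.
Qed.

Lemma interior_center H T c c' a : periodic_param H ->
  0 < a < 2 * pi -> simple_curve_segment c -> simple_curve_segment c' ->
  c 0 = H T -> c' 0 = H T ->
  (forall u, 0 <= u <= 1 -> range H (c u)) ->
  (forall u, 0 <= u <= 1 -> range H (c' u)) ->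
  (forall u, 0 <= u <= 1 -> range H (rotation a (H T) (c u))) ->
  (forall u, 0 <= u <= 1 -> range H (rotation a (H T) (c' u))) ->
  (forall u v, 0 < u <= 1 -> 0 < v <= 1 -> c u <> c' v) ->
  swept_arc (H T) a (c 1) `<=` range H ->
  swept_arc (H T) a (c' 1) `<=` range H -> False.
Proof.
move=> PH aa sc sc' c0 c'0 rc rc' rr rr' dj sw sw'.
have [[psi hb]|[psi hb]] := branch PH sc rc c0.
  exact: (interior_center_aligned PH aa sc sc' c0 c'0 rc rc' rr rr' dj sw sw' hb).
have bT : H (- (- (T + 1))) = H T by rewrite opprK paramD1.
have ro x : range H x -> range (fun s => H (- s)) x.
  by move=> [s _ <-]; exists (- s); rewrite ?opprK.
apply: (interior_center_aligned (H := fun s => H (- s)) (T := - (T + 1))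
  (c := c) (c' := c') (a := a) (psi := psi)); rewrite ?bT //.
- exact: periodic_param_opp.
- by move=> u /rc/ro.
- by move=> u /rc'/ro.
- by move=> u /rr/ro.
- by move=> u /rr'/ro.
- by move=> x /sw/ro.
- by move=> x /sw'/ro.
Qed.

Lemma simple_curve_segment_affine (eta : R -> plane R) (x y : R) :
  0 <= x <= 1 -> 0 <= y <= 1 -> x != y -> simple_curve_segment eta ->
  simple_curve_segment (fun u => eta (x + u * (y - x))).
Proof.
move=> /andP[x0 x1] /andP[y0 y1] xy [ce ie].
have A u : u \in `[0, 1] -> x + u * (y - x) \in `[0, 1].
  by rewrite !in_itv /= => /andP[u0 u1]; apply/andP; split; nra.
split; last first.
  move=> s t /A sA /A tA /(ie _ _ sA tA) /addrI /mulIf; apply.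
  by rewrite subr_eq0 eq_sym.
apply/subspace_continuousP => u /A uA.
move/subspace_continuousP : ce => /(_ _ uA) ce V /ce hV.
have {}hV : \forall z \near x + u * (y - x), `[0, 1]%classic z -> V (eta z).
  exact: hV.
have : {for u, continuous (fun u : R => x + u * (y - x))}.
  by apply: cvgD; [exact: cvg_cst|exact: mulrr_continuous].
move=> /(_ _ hV) {}hV.
have {}hV : \forall z \near u,
    `[0, 1]%classic (x + z * (y - x)) -> V (eta (x + z * (y - x))).
  exact: hV.
change (\forall z \near u, `[0, 1]%classic z -> V (eta (x + z * (y - x)))).
by apply: filterS hV => z hz /A; exact: hz.
Qed.

Lemma radial_form_of_contour H T (eta : R -> plane R) a : periodic_param H ->
  simple_curve_segment eta -> (eta @` `[0, 1]) (H T) -> 0 < a < 2 * pi ->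
  contour eta (H T) a `<=` range H ->
  exists b e d psi psi', radial_form H (H T) T b e d psi psi'.
Proof.
move=> PH se [s0]; rewrite /= in_itv /= => s01 hs aa cn.
have i0 : 0 <= (0 : R) <= 1 by rewrite lexx ler01.
have i1 : 0 <= (1 : R) <= 1 by rewrite lexx ler01.
have seg (x y u : R) : 0 <= x <= 1 -> 0 <= y <= 1 -> 0 <= u <= 1 ->
    0 <= x + u * (y - x) <= 1.
  by move=> /andP[? ?] /andP[? ?] /andP[? ?]; apply/andP; split; nra.
have re u : 0 <= u <= 1 -> range H (eta u).
  by move=> u01; apply: cn; left; left; exists u; rewrite //= in_itv.
have rr u : 0 <= u <= 1 -> range H (rotation a (H T) (eta u)).
  by move=> u01; apply: cn; left; right; exists (eta u).
have w0 : swept_arc (H T) a (eta 0) `<=` range H.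
  by move=> x hx; apply: cn; right; left.
have w1 : swept_arc (H T) a (eta 1) `<=` range H.
  by move=> x hx; apply: cn; right; right.
pose c (x u : R) := eta (s0 + u * (x - s0)).
have c0 (x : R) : c x 0 = H T by rewrite /c mul0r addr0.
have c1 (x : R) : c x 1 = eta x by rewrite /c mul1r addrC subrK.
have [e0|n0] := eqVneq s0 0.
  apply: (radial_form_endpoint PH aa (c := c 1)); rewrite ?c0 ?c1 //.
  - by apply: simple_curve_segment_affine; rewrite // e0 eq_sym oner_eq0.
  - by move=> u u01; apply: re; exact: seg.
  - by move=> u u01; apply: rr; exact: seg.
have [e1|n1] := eqVneq s0 1.
  apply: (radial_form_endpoint PH aa (c := c 0)); rewrite ?c0 ?c1 //.
  - by apply: simple_curve_segment_affine; rewrite // e1 oner_eq0.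
  - by move=> u u01; apply: re; exact: seg.
  - by move=> u u01; apply: rr; exact: seg.
exfalso; apply: (interior_center PH aa (c := c 0) (c' := c 1)); rewrite ?c0 ?c1 //.
- exact: simple_curve_segment_affine.
- exact: simple_curve_segment_affine.
- by move=> u u01; apply: re; exact: seg.
- by move=> u u01; apply: re; exact: seg.
- by move=> u u01; apply: rr; exact: seg.
- by move=> u u01; apply: rr; exact: seg.
move=> u v /andP[u0 u1] /andP[v0 v1] /se.2 e.
have s0p : 0 < s0 by rewrite lt_neqAle eq_sym n0; case/andP: s01.
have s1p : s0 < 1 by rewrite lt_neqAle n1; case/andP: s01.
have : s0 + u * (0 - s0) = s0 + v * (1 - s0).
  by apply: e; rewrite in_itv /=; apply: seg => //; rewrite ?u1 ?v1 ?(ltW u0) ?(ltW v0).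
have : 0 < u * s0 by rewrite mulr_gt0.
have : 0 < v * (1 - s0) by rewrite mulr_gt0 // subr_gt0.
lra.
Qed.

End Center.

(** * Inner points of circular arcs of the curve *)

Section Regular.
Variable R : realType.
Implicit Types (H : R -> plane R) (s t u v w T a b c d e dl rsq : R).
Implicit Types (p q o x y : plane R) (psi : R -> R).

(** It depends on [H] through its range only, hence is invariant under reversal of the curve. Its
    failure at a point is how maximality of an arc is expressed. *)
Definition regular H rsq x := exists o e, [/\ 0 < e, sqdist o x = rsq &
  forall u, `|u| < e -> range H (rotation u o x)].

Lemma range_opp H : range (fun s => H (- s)) = range H.
Proof.
apply/seteqP; split=> x [s _ <-]; first by exists (- s).
by exists (- s) => //; rewrite opprK.
Qed.

Lemma regular_opp H rsq x : regular (fun s => H (- s)) rsq x = regular H rsq x.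
Proof. by rewrite /regular range_opp. Qed.

Section Param.
Variable H : R -> plane R.
Hypothesis PH : periodic_param H.

Lemma lift_near (f : R -> plane R) t e e' : {for 0, continuous f} ->
  f 0 = H t -> 0 < e -> (forall u, `|u| < e -> range H (f u)) -> 0 < e' ->
  exists2 e2, 0 < e2 & forall u, `|u| < e2 -> exists2 s, `|s - t| < e' & H s = f u.
Proof.
move=> cf f0 e0 rf e'0; pose T := t - 1 / 2.
have tT : T < t < T + 1 by rewrite /T; apply/andP; split; lra.
have tT' : T <= t < T + 1 by case/andP: tT => /ltW -> ->.
have nT : f 0 <> H T by rewrite f0; exact: param_neq_base.
have r0 : range H (f 0) by apply: rf; rewrite normr0.
have := theta_continuous PH r0 nT e'0.
rewrite (_ : theta H T (f 0) = t); last by rewrite f0 thetaK.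
move=> nb; have {nb} /nbhs_ballP[d /= d0 hd] := cf _ nb.
exists (Num.min d e); first by rewrite lt_min d0 e0.
move=> u; rewrite lt_min => /andP[ud ue].
have [_ h2] := thetaP PH T (rf u ue).
exists (theta H T (f u)) => //; apply: (hd u) => //; last exact: rf.
by rewrite /ball /= sub0r normrN.
Qed.

(** Regularity speaks of points; this controls parameters. The coordinate of the arc is continuous
    and injective in the angle, so its values fill a neighbourhood of [t]. *)
Lemma regular_param t o e rsq e' : 0 < rsq -> 0 < e -> sqdist o (H t) = rsq ->
  (forall u, `|u| < e -> range H (rotation u o (H t))) -> 0 < e' ->
  exists2 e2, 0 < e2 & forall s, `|s - t| < e2 ->
    exists2 u, `|u| < e' & H s = rotation u o (H t).
Proof.
move=> r20 e0 ho rf e'0; pose T := t - 1 / 2; pose f u := rotation u o (H t).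
have tT' : T <= t < T + 1 by rewrite /T; apply/andP; split; lra.
have xo : H t <> o by move=> E; move: r20; rewrite -ho E sqdist_xx ltxx.
have f0 : f 0 = H t by rewrite /f rotation0.
have cf : continuous f by exact: continuous_rotation_angle.
(* Less than [1 / 2], the distance from [t] to the cut of the window. *)
have q0 : (0 : R) < 1 / 4 by lra.
have [e2 e20 he2] := lift_near (cf 0) f0 e0 rf q0.
have pi0 := pi_gt0 R.
pose m := Num.min (Num.min e e') (Num.min e2 pi).
have m0 : 0 < m by rewrite !lt_min e0 e'0 e20 pi0.
have [me me' me2 mpi] : [/\ m <= e, m <= e', m <= e2 & m <= pi].
  by split; rewrite /m !ge_min lexx ?orbT.
have dm u : - (m / 2) <= u <= m / 2 -> `|u| < m.
  by move=> /andP[? ?]; rewrite ltr_norml; apply/andP; split; lra.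
have cth : {within `[- (m / 2), m / 2], continuous (fun u => theta H T (f u))}.
  apply: theta_within => //; first exact: continuous_subspaceT.
  move=> u /=; rewrite in_itv /= => /dm um; split.
    by apply: rf; exact: lt_le_trans me.
  have [s st <-] := he2 u (lt_le_trans um me2).
  apply: param_neq_base => //; move: st; rewrite ltr_norml /T => /andP[? ?].
  by apply/andP; split; lra.
have ith : {in `[- (m / 2), m / 2] &, injective (fun u => theta H T (f u))}.
  move=> u v; rewrite !in_itv /= => um vm E.
  have [_ hu] := thetaP PH T (rf u (lt_le_trans (dm u um) me)).
  have [_ hv] := thetaP PH T (rf v (lt_le_trans (dm v vm) me)).
  have : f u = f v by rewrite /f -hu -hv -/(f u) -/(f v) E.
  move=> /(rotation_inj_angle xo); apply; rewrite ltr_norml.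
  by move: um vm => /andP[? ?] /andP[? ?]; apply/andP; split; lra.
have th0 : theta H T (f 0) = t by rewrite f0 thetaK.
have i1 : - (m / 2) \in `[- (m / 2), m / 2] by rewrite in_itv /= lexx /=; lra.
have i2 : m / 2 \in `[- (m / 2), m / 2] by rewrite in_itv /= lexx andbT; lra.
have i0 : 0 \in `[- (m / 2), m / 2] by rewrite in_itv /=; apply/andP; split; lra.
have le12 : - (m / 2) <= m / 2 by lra.
have key k : 0 < k -> (forall s, `|s - t| < k ->
    Num.min (theta H T (f (- (m / 2)))) (theta H T (f (m / 2))) <= s <=
    Num.max (theta H T (f (- (m / 2)))) (theta H T (f (m / 2)))) ->
    exists2 e2, 0 < e2 & forall s, `|s - t| < e2 ->
    exists2 u, `|u| < e' & H s = rotation u o (H t).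
  move=> k0 hk; exists k => // s /hk/(IVT le12 cth)[u]; rewrite in_itv /= => um <-.
  exists u; first exact: lt_le_trans (dm u um) me'.
  by have [_ ->] := thetaP PH T (rf u (lt_le_trans (dm u um) me)).
have [hm|hm] := itv_continuous_inj_mono cth ith.
  have h1 : theta H T (f (- (m / 2))) < t by rewrite -[ltRHS]th0; apply: hm => //; lra.
  have h2 : t < theta H T (f (m / 2)) by rewrite -[ltLHS]th0; apply: hm => //; lra.
  set A := theta _ _ _ in h1 key *; set B := theta _ _ _ in h2 key *.
  apply: (key (Num.min (t - A) (B - t))).
    by rewrite lt_min !subr_gt0 h1 h2.
  move=> s; rewrite lt_min !ltr_norml => /andP[/andP[H1 H2] /andP[H3 H4]].
  have AB : A <= B by rewrite ltW // (lt_trans h1).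
  by rewrite (min_idPl AB) (max_idPr AB); clear -h1 h2 H1 H2 H3 H4;
    apply/andP; split; lra.
have h1 : t < theta H T (f (- (m / 2))) by rewrite -[ltLHS]th0; apply: hm => //; lra.
have h2 : theta H T (f (m / 2)) < t by rewrite -[ltRHS]th0; apply: hm => //; lra.
set A := theta _ _ _ in h1 key *; set B := theta _ _ _ in h2 key *.
apply: (key (Num.min (A - t) (t - B))).
  by rewrite lt_min !subr_gt0 h1 h2.
move=> s; rewrite lt_min !ltr_norml => /andP[/andP[H1 H2] /andP[H3 H4]].
have AB : B <= A by rewrite ltW // (lt_trans h2).
by rewrite (min_idPr AB) (max_idPl AB); clear -h1 h2 H1 H2 H3 H4;
  apply/andP; split; lra.
Qed.

Lemma circle_center_param T s1 s2 s3 o o' r r' :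
  T <= s1 -> s1 < s2 -> s2 < s3 -> s3 < T + 1 ->
  (forall s, s \in [:: s1; s2; s3] ->
    sqdist o (H s) = r /\ sqdist o' (H s) = r') -> o = o'.
Proof.
move=> h1 h2 h3 h4 h.
apply: (@circle_center_unique _ o o' r r' (H s1) (H s2) (H s3)).
- by apply: (param_neq PH (T := T)) => //; lra.
- by apply: (param_neq PH (T := T)) => //; lra.
- by apply: (param_neq PH (T := T)) => //; lra.
move=> x; rewrite !inE => /or3P[] /eqP ->; apply: h; by rewrite !inE eqxx ?orbT.
Qed.

Lemma regular_rotation rsq s s1 s2 a p : regular H rsq (H s) -> s1 < s < s2 ->
  (forall s', s1 < s' < s2 -> range H (rotation a p (H s'))) ->
  regular H rsq (rotation a p (H s)).
Proof.
move=> [ o [e [e0 ho rf]]] /andP[h1 h2] rr.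
have cf : {for 0, continuous (fun u => rotation u o (H s))}.
  exact: continuous_rotation_angle.
have k0 : 0 < Num.min (s - s1) (s2 - s) by rewrite lt_min !subr_gt0 h1 h2.
have [e2 e20 he2] := lift_near cf (rotation0 o (H s)) e0 rf k0.
exists (rotation a p o), e2; split=> //; first by rewrite sqdist_rotation.
move=> u /he2[s']; rewrite lt_min !ltr_norml => /andP[/andP[? ?] /andP[? ?]] E.
by rewrite -rotation_conj -E; apply: rr; apply/andP; split; lra.
Qed.

End Param.

Section Irregular.
Variables (rsq : R).
Hypothesis rsq_gt0 : 0 < rsq.

(** A circle through [H b] would agree with the arc after [b], so have centre [p], and continue
    before [b]. A point just before [b] would then be either on the arc already, or turned by a
    small angle against [d]; in the latter case its image on the other branch falls on the arc. Both
    contradict injectivity. *)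
Lemma irregular_arc_start H p T b c d psi psi' : periodic_param H ->
  radial_form H p T b c d psi psi' -> ~ regular H rsq (H b).
Proof.
move=> PH rf [ o [e [e0 ho rg]]].
have [Tb bc cT d0] := And4 (rf_Tb rf) (rf_bc rf) (rf_cT rf) (rf_angle0 rf).
have d_gt0 : 0 < `|d| by rewrite normr_gt0.
have [e2 e20 he2] := regular_param PH rsq_gt0 e0 ho rg d_gt0.
have op : o = p.
  pose m := Num.min e2 (c - b).
  have m0 : 0 < m by rewrite lt_min e20 subr_gt0.
  have me : m <= e2 by rewrite ge_min lexx.
  have mc : m <= c - b by rewrite ge_min lexx orbT.
  apply: (@circle_center_param H PH T (b + m / 4) (b + m / 3) (b + m / 2) o p
    rsq (sqdist p (H b))); try lra.
  have key s : b < s -> s < b + m ->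
      sqdist o (H s) = rsq /\ sqdist p (H s) = sqdist p (H b).
    move=> s0 s1; split.
      have [|u _ ->] := he2 s; first by rewrite ltr_norml; apply/andP; split; lra.
      by rewrite sqdist_rotation_center.
    have /(rf_arc rf)[v _ <-] : exists2 s', b <= s' <= c & H s' = H s.
      by exists s => //; apply/andP; split; lra.
    by rewrite sqdist_rotation_center.
  by move=> s; rewrite !inE => /or3P[] /eqP ->; apply: key; lra.
pose m := Num.min e2 (b - T).
have m0 : 0 < m by rewrite lt_min e20 subr_gt0.
have me : m <= e2 by rewrite ge_min lexx.
have mT : m <= b - T by rewrite ge_min lexx orbT.
pose s := b - m / 2.
have [|u ud hs] := he2 s.
  by rewrite /s ltr_norml; apply/andP; split; lra.
have sT : T < s < b by rewrite /s; apply/andP; split; lra.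
move: sT => /andP[Ts sb]; rewrite op in hs.
have vd : `|u / d| < 1 by rewrite normf_div ltr_pdivrMr // mul1r.
move: vd; rewrite ltr_norml => /andP[v1 v2].
have [v0|v0] := leP 0 (u / d).
  have /(rf_arc rf)[s' /andP[s'0 s'1] /(param_inj PH (T := T)) E] :
      exists2 v, 0 <= v <= 1 & rotation (v * d) p (H b) = H s.
    by exists (u / d); rewrite ?divfK // v0 ltW.
  have : s' = s by apply: E; apply/andP; split; lra.
  by lra.
have [|w /andP[w0 w1] hw] := rf_onto rf (s := s); first by apply/andP; split; lra.
have w_gt0 : 0 < w.
  rewrite lt_neqAle w0 andbT; apply/eqP => E.
  by move: hw; rewrite -E (rf_psi0 rf); lra.
have c1 : c <= psi' w.
  rewrite -(rf_psi'1 rf); move: (w1); rewrite le_eqVlt => /predU1P[-> //|w1'].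
  by apply/ltW/(rf_decr rf).
have c2 : psi' w < T + 1.
  by rewrite -(rf_psi'0 rf); apply: (rf_decr rf).
have /(rf_arc rf)[s' /andP[s'0 s'1] /(param_inj PH (T := T)) E] :
    exists2 v, 0 <= v <= 1 & rotation (v * d) p (H b) = H (psi' w).
  exists (1 + u / d); first by apply/andP; split; lra.
  rewrite (rf_rot rf) ?w0 // hw hs rotationD; congr rotation.
  by rewrite mulrDl divfK // mul1r.
have {}E : s' = psi' w by apply: E; apply/andP; split; lra.
have : psi' w = psi' 1 by rewrite (rf_psi'1 rf); lra.
move: w1; rewrite le_eqVlt => /predU1P[w1|w1].
  by move: hw; rewrite w1 (rf_psi1 rf); lra.
by have := rf_decr rf w0 w1 (lexx 1); lra.
Qed.

Lemma irregular_arc_end H p T b c d psi psi' : periodic_param H ->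
  radial_form H p T b c d psi psi' -> ~ regular H rsq (H c).
Proof.
move=> PH rf; have := irregular_arc_start (periodic_param_opp PH)
  (radial_form_opp PH rf).
by rewrite regular_opp opprK.
Qed.

(** A circle through the centre would contain both branches near it. The rotation maps one to the
    other, so it fixes the centre [o] of that circle; then [o = p], at distance zero from the
    circle. *)
Lemma irregular_center H p T b c d psi psi' : periodic_param H ->
  radial_form H p T b c d psi psi' -> ~ regular H rsq (H T).
Proof.
move=> PH rf [ o [e1 [e10 ho rg]]].
have [Tb bc cT d0] := And4 (rf_Tb rf) (rf_bc rf) (rf_cT rf) (rf_angle0 rf).
have [e e0 he] := regular_param PH rsq_gt0 e10 ho rg ltr01.
have circ s : `|s - T| < e -> sqdist o (H s) = rsq.
  by move=> /he[u _ ->]; rewrite sqdist_rotation_center.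
have [w1 /andP[w10 w11] hw1] : exists2 u, 0 <= u <= 1 & psi u = Num.min b (T + e / 2).
  by apply: (rf_onto rf); rewrite le_min ge_min lexx; apply/andP; split; lra.
have [w2 /andP[w20 w21] hw2] : exists2 u, 0 <= u <= 1 & psi' u = Num.max c (T + 1 - e / 2).
  by apply: (rf_onto' rf); rewrite ge_max le_max lexx; apply/andP; split; lra.
have w1p : 0 < w1.
  rewrite lt_neqAle w10 andbT; apply/eqP => E; move: hw1; rewrite -E (rf_psi0 rf).
  by case: leP; lra.
have w2p : 0 < w2.
  rewrite lt_neqAle w20 andbT; apply/eqP => E; move: hw2; rewrite -E (rf_psi'0 rf).
  by case: leP; lra.
(* Up to index [w] both branches stay within [e] of the base parameter, where the curve is on the
   circle. *)
pose w := Num.min w1 w2.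
have wp : 0 < w by rewrite lt_min w1p.
have ww1 : w <= w1 by rewrite ge_min lexx.
have ww2 : w <= w2 by rewrite ge_min lexx orbT.
have b1 v : 0 < v -> v <= w -> T < psi v < T + e.
  move=> v0 vw; apply/andP; split.
    by rewrite -(rf_psi0 rf); apply: (rf_incr rf); lra.
  have h : psi v <= psi w1.
    have : v <= w1 by lra.
    by rewrite le_eqVlt => /predU1P[-> //|h]; apply/ltW/(rf_incr rf) => //; lra.
  have : psi w1 <= T + e / 2 by rewrite hw1 ge_min lexx orbT.
  by lra.
have b2 v : 0 < v -> v <= w -> c <= psi' v < T + 1 /\ T + 1 - e < psi' v.
  move=> v0 vw; have h : psi' w2 <= psi' v.
    have : v <= w2 by lra.
    by rewrite le_eqVlt => /predU1P[-> //|h]; apply/ltW/(rf_decr rf) => //; lra.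
  have h1 : c <= psi' w2 by rewrite hw2 le_max lexx.
  have h2 : T + 1 - e / 2 <= psi' w2 by rewrite hw2 le_max lexx orbT.
  split; last by lra.
  apply/andP; split; first by lra.
  by rewrite -(rf_psi'0 rf); apply: (rf_decr rf); lra.
have oo : o = rotation d p o.
  have [/andP[c1 c1'] _] := b2 w wp (lexx _).
  have [/andP[c2 c2'] _] := b2 (w / 2) ltac:(lra) ltac:(lra).
  have [/andP[c3 c3'] _] := b2 (w / 3) ltac:(lra) ltac:(lra).
  apply: (@circle_center_param H PH T (psi' w) (psi' (w / 2)) (psi' (w / 3)) o
    (rotation d p o) rsq rsq) => //; try lra.
  - by apply: (rf_decr rf); lra.
  - by apply: (rf_decr rf); lra.
  have key v : 0 < v -> v <= w ->
      sqdist o (H (psi' v)) = rsq /\ sqdist (rotation d p o) (H (psi' v)) = rsq.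
    move=> v0 vw; have [/andP[k1 k2] k3] := b2 v v0 vw; split.
      rewrite -(subrK 1 (psi' v)) paramD1 //; apply: circ.
      by rewrite ltr_norml; apply/andP; split; lra.
    rewrite (rf_rot rf) ?sqdist_rotation; last by apply/andP; split; lra.
    apply: circ; have /andP[? ?] := b1 v v0 vw.
    by rewrite ltr_norml; apply/andP; split; lra.
  by move=> s; rewrite !inE => /or3P[] /eqP ->; apply: key; lra.
have op : o = p.
  apply: contrapT => op; have := rotation_fixed op (rf_angle rf) (esym oo).
  by move=> E; rewrite E eqxx in d0.
by move: rsq_gt0; rewrite -ho op (rf_base rf) sqdist_xx ltxx.
Qed.

(** For inner [u] a neighbourhood on one branch is rotated into the curve. At [u = 0] the two points
    coincide, and at [u = 1] both are irregular. *)
Lemma regular_mirror H p T b c d psi psi' u : periodic_param H ->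
  radial_form H p T b c d psi psi' -> 0 <= u <= 1 ->
  regular H rsq (H (psi u)) <-> regular H rsq (H (psi' u)).
Proof.
move=> PH rf /andP[u0 u1].
have [Tb bc cT d0] := And4 (rf_Tb rf) (rf_bc rf) (rf_cT rf) (rf_angle0 rf).
have [->|un0] := eqVneq u 0; first by rewrite (rf_psi0 rf) (rf_psi'0 rf) paramD1.
have [->|un1] := eqVneq u 1.
  rewrite (rf_psi1 rf) (rf_psi'1 rf).
  split=> h; exfalso.
    exact: (irregular_arc_start PH rf h).
  exact: (irregular_arc_end PH rf h).
have {}u0 : 0 < u by rewrite lt_neqAle eq_sym un0.
have {}u1 : u < 1 by rewrite lt_neqAle un1.
have u01 : 0 <= u <= 1 by rewrite !ltW.
split=> h.
  rewrite (rf_rot rf) //; apply: (regular_rotation PH (s1 := T) (s2 := b)) => //.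
    have := rf_incr rf (lexx 0) u0 (ltW u1).
    have := rf_incr rf (ltW u0) u1 (lexx 1).
    by rewrite (rf_psi0 rf) (rf_psi1 rf) => -> ->.
  move=> s /andP[s0 s1]; have [|v v01 <-] := rf_onto rf (s := s).
    by rewrite !ltW.
  by rewrite -(rf_rot rf) //; exists (psi' v).
have -> : H (psi u) = rotation (- d) p (H (psi' u)).
  by rewrite (rf_rot rf) // rotationK.
apply: (regular_rotation PH (s1 := c) (s2 := T + 1)) => //.
  have := rf_decr rf (lexx 0) u0 (ltW u1).
  have := rf_decr rf (ltW u0) u1 (lexx 1).
  by rewrite (rf_psi'0 rf) (rf_psi'1 rf) => -> ->.
move=> s /andP[s0 s1]; have [|v v01 <-] := rf_onto' rf (s := s).
  by rewrite !ltW.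
by rewrite (rf_rot rf) // rotationK; exists (psi v).
Qed.

End Irregular.

End Regular.

(** * Maximal arcs of given radius and angle, and their mirror images *)

Section Arcs.
Variable R : realType.
Implicit Types (H : R -> plane R) (s t u v w T a b c d e f dl rsq : R).
Implicit Types (p q o x y : plane R) (psi : R -> R).

(* The irregularity of the end points expresses that the arc is maximal. *)
Definition arc_piece H rsq dl a e :=
  [/\ a < e, e < a + 1, ~ regular H rsq (H a), ~ regular H rsq (H e) &
   exists o, [/\ sqdist o (H a) = rsq, H e = rotation dl o (H a) &
     forall x, (exists2 s, a <= s <= e & H s = x) <->
       (exists2 v, 0 <= v <= 1 & rotation (v * dl) o (H a) = x)]].

Lemma sqdist_rotation_self u o x :
  sqdist x (rotation u o x) = 2 * (1 - cos u) * sqdist o x.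
Proof.
rewrite /sqdist /rotation /=.
have e : sin u * sin u = 1 - cos u * cos u.
  by rewrite -(cos2Dsin2 u) !expr2; ring.
transitivity ((1 - 2 * cos u + (cos u * cos u + sin u * sin u)) *
  ((o.1 - x.1) ^+ 2 + (o.2 - x.2) ^+ 2)); first by ring.
by rewrite e; ring.
Qed.

Lemma sqdist_triangle x y z :
  sqdist x z <= 2 * (sqdist y x + sqdist y z) :> R.
Proof.
rewrite /sqdist -subr_ge0.
have -> : 2 * ((y.1 - x.1) ^+ 2 + (y.2 - x.2) ^+ 2 +
    ((y.1 - z.1) ^+ 2 + (y.2 - z.2) ^+ 2)) -
    ((x.1 - z.1) ^+ 2 + (x.2 - z.2) ^+ 2) =
    ((y.1 - x.1) + (y.1 - z.1)) ^+ 2 + ((y.2 - x.2) + (y.2 - z.2)) ^+ 2 by ring.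
by rewrite addr_ge0 ?sqr_ge0.
Qed.

Section Pieces.
Variables (H : R -> plane R) (rsq : R).
Lemma arc_circle dl a e : arc_piece H rsq dl a e ->
  exists2 o, H e = rotation dl o (H a) &
    forall s, a <= s <= e -> sqdist o (H s) = rsq.
Proof.
move=> [_ _ _ _ [ o [ho he arc]]]; exists o => // s sae.
have /arc[v _ <-] : exists2 s', a <= s' <= e & H s' = H s by exists s.
by rewrite sqdist_rotation_center.
Qed.

(** The image arc is run through backwards, from the image of [e] to that of [b], while the rotation
    keeps the sense of turning; hence [- dl]. *)
Lemma arc_rotation a p dl b e c f : arc_piece H rsq dl b e ->
  c < f -> f < c + 1 ->
  ~ regular H rsq (H c) -> ~ regular H rsq (H f) ->
  H c = rotation a p (H e) -> H f = rotation a p (H b) ->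
  (forall s, b <= s <= e -> exists2 s', c <= s' <= f & H s' = rotation a p (H s)) ->
  (forall s', c <= s' <= f -> exists2 s, b <= s <= e & H s' = rotation a p (H s)) ->
  arc_piece H rsq (- dl) c f.
Proof.
move=> [be eb nb ne [ o [ho he arc]]] cf fc nc nf hc hf fw bw.
split=> //; exists (rotation a p o); split.
- by rewrite hc sqdist_rotation he sqdist_rotation_center.
- by rewrite hc -rotation_conj he rotationK -hf.
move=> x; split.
  move=> [s' /bw[s sbe hs] <-].
  have /arc[v /andP[v0 v1] hv] : exists2 s', b <= s' <= e & H s' = H s by exists s.
  exists (1 - v); first by apply/andP; split; lra.
  rewrite hs -hv hc -rotation_conj he rotationD; congr (rotation a p (rotation _ o _)).
  by ring.
move=> [v /andP[v0 v1] <-].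
have /arc[s /fw[s' s'cf hs'] hs] : exists2 w, 0 <= w <= 1 &
    rotation (w * dl) o (H b) = rotation ((1 - v) * dl) o (H b).
  by exists (1 - v) => //; apply/andP; split; lra.
exists s' => //; rewrite hs' hs hc -rotation_conj he rotationD.
by congr (rotation a p (rotation _ o _)); ring.
Qed.

Hypothesis PH : periodic_param H.

(** Combined with the irregular ends, this makes two arcs of the family equal or non-overlapping. *)
Lemma arc_interior dl a e s : dl != 0 -> arc_piece H rsq dl a e ->
  a < s < e -> regular H rsq (H s).
Proof.
move=> d0 [ae ea na ne [ o [ho he arc]]] /andP[s0 s1].
have [v /andP[v0 v1] hv] : exists2 v, 0 <= v <= 1 & rotation (v * dl) o (H a) = H s.
  by apply/arc; exists s; rewrite ?ltW.
have vn0 : v != 0.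
  apply/eqP => E; move: hv; rewrite E mul0r rotation0.
  by apply: (param_neq PH (T := a)) => //; lra.
have vn1 : v != 1.
  apply/eqP => E; move: hv; rewrite E mul1r -he => /esym.
  by apply: (param_neq PH (T := a)) => //; lra.
have {}v0 : 0 < v by rewrite lt_neqAle eq_sym vn0.
have {}v1 : v < 1 by rewrite lt_neqAle vn1.
have dn : 0 < `|dl| by rewrite normr_gt0.
exists o, (Num.min v (1 - v) * `|dl|); split.
- by rewrite mulr_gt0 // lt_min v0 subr_gt0.
- by rewrite -hv sqdist_rotation_center.
move=> u hu; have : `|u / dl| < Num.min v (1 - v).
  by rewrite normf_div ltr_pdivrMr.
rewrite lt_min !ltr_norml => /andP[/andP[h1 h2] /andP[h3 h4]].
have /arc[s' _ <-] : exists2 w, 0 <= w <= 1 &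
    rotation (w * dl) o (H a) = rotation u o (H s); last by exists s'.
exists (u / dl + v); first by apply/andP; split; lra.
by rewrite -hv rotationD mulrDl divfK.
Qed.

Lemma arc_end_le dl dl' a e e' : dl' != 0 ->
  arc_piece H rsq dl a e -> arc_piece H rsq dl' a e' -> e' <= e.
Proof.
move=> d0 [ae _ _ ne _] A'; rewrite leNgt; apply/negP => ee'; apply: ne.
by apply: (arc_interior d0 A'); rewrite ae.
Qed.

Lemma arc_end_unique dl dl' a e e' : dl != 0 -> dl' != 0 ->
  arc_piece H rsq dl a e -> arc_piece H rsq dl' a e' -> e = e'.
Proof.
move=> d0 d0' A A'; apply/eqP.
by rewrite eq_le (arc_end_le d0 A' A) (arc_end_le d0' A A').
Qed.

Lemma arc_disjoint dl dl' a e a' e' : dl != 0 ->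
  arc_piece H rsq dl a e -> arc_piece H rsq dl' a' e' -> a < a' -> e <= a'.
Proof.
move=> d0 A [_ _ na' _ _] aa'; rewrite leNgt; apply/negP => ae; apply: na'.
by apply: (arc_interior d0 A); rewrite aa'.
Qed.

(** Both arcs would have the same ends and the same centre, so turning by [dl] and by [- dl] would
    agree and [dl] would be [pi]. The midpoint separates the two half-circles. *)
Lemma arc_sign dl a e e' : 0 < rsq -> 0 < dl < 2 * pi ->
  arc_piece H rsq dl a e -> arc_piece H rsq (- dl) a e' -> False.
Proof.
move=> rsq_gt0 /andP[d_gt0 d2] A A'; have d0 : dl != 0 by rewrite lt0r_neq0.
have ee : e = e' by apply: (arc_end_unique d0 _ A A'); rewrite oppr_eq0.
subst e'; have [ae ea _ _ [ o [ho he arc]]] := A.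
have [_ _ _ _ [ o' [ho' he' arc']]] := A'.
have oo : o = o'.
  apply: (@circle_center_param _ _ PH a a ((a + e) / 2) e o o' rsq rsq); try lra.
  have key s : a <= s <= e -> sqdist o (H s) = rsq /\ sqdist o' (H s) = rsq.
    move=> sae; split.
      have /arc[v _ <-] : exists2 s', a <= s' <= e & H s' = H s by exists s.
      by rewrite sqdist_rotation_center.
    have /arc'[v _ <-] : exists2 s', a <= s' <= e & H s' = H s by exists s.
    by rewrite sqdist_rotation_center.
  by move=> s; rewrite !inE => /or3P[] /eqP ->; apply: key; apply/andP; split; lra.
subst o'; have xo : H a <> o.
  by move=> E; move: rsq_gt0; rewrite -ho E sqdist_xx ltxx.
have d_pi : dl = pi.
  apply: (rotation_double xo); first by rewrite d_gt0.
  by rewrite -rotationD -he he' rotationNK.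
have /arc/arc'[v /andP[v0 v1]] : exists2 v, 0 <= v <= 1 &
    rotation (v * dl) o (H a) = rotation (1 / 2 * dl) o (H a).
  by exists (1 / 2) => //; apply/andP; split; lra.
move=> /(rotation_inj_angle xo) E.
have vd0 : 0 <= v * dl by rewrite mulr_ge0 // ltW.
have vd1 : v * dl <= dl by rewrite ger_pMl.
have : v * - dl = 1 / 2 * dl.
  by apply: E; rewrite mulrN ltr_norml; apply/andP; split; lra.
by rewrite mulrN; lra.
Qed.

Lemma arc_shift (k : int) dl a e :
  arc_piece H rsq dl a e -> arc_piece H rsq dl (a + k%:~R) (e + k%:~R).
Proof.
have hk s : H (s + k%:~R) = H s.
  by apply/(PH.2 _ _); exists k; rewrite addrAC subrr add0r.
have hk' s : H (s - k%:~R) = H s.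
  by apply/(PH.2 _ _); exists (- k); rewrite mulrNz addrAC subrr add0r.
move=> [ae ea na ne [ o [ho he arc]]].
split; rewrite ?hk ?ltrD2r //; first by lra.
exists o; split=> // x; rewrite -arc; split=> -[s /andP[s0 s1] <-].
  by exists (s - k%:~R); rewrite ?hk' //; apply/andP; split; lra.
by exists (s + k%:~R); rewrite ?hk //; apply/andP; split; lra.
Qed.

(** Otherwise the starts accumulate at some [l]. Between two starts close to [l] lies a whole arc,
    with a chord of squared length [D] subtending the angle [al / 2]. Continuity at [l] bounds
    squared distances to [H l] by [D / 4], and the factor 2 of [sqdist_triangle] makes the chord
    shorter than that. *)
Lemma arc_starts_finite (al T : R) : 0 < rsq -> 0 < al < 2 * pi ->
  finite_set [set a | T <= a < T + 1 /\
    exists dl e, `|dl| = al /\ arc_piece H rsq dl a e].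
Proof.
move=> rsq_gt0 /andP[al0 al2]; apply: contrapT => inf.
set E := [set a | _] in inf.
have bE : bounded_set E.
  exists (`|T| + 1); split; first exact: num_real.
  move=> M hM a [/andP[a0 a1] _] /=; apply: le_trans (ltW hM).
  rewrite ler_norml; move: (ler_norm T) (ler_norm (- T)); rewrite normrN => ? ?.
  by apply/andP; split; lra.
have [l El] := infinite_bounded_limit_point_nonempty inf bE.
pose D := 2 * (1 - cos (al / 2)) * rsq.
have D0 : 0 < D.
  rewrite !mulr_gt0 // subr_gt0 lt_neqAle cos_le1 andbT; apply/eqP => /cos_eq1 h.
  have : al / 2 = 0 by apply: h; rewrite ltr_norml; apply/andP; split; lra.
  by lra.
have cf : continuous (fun s => sqdist (H l) (H s)).
  move=> s; apply: (@continuous_comp _ _ _ H (sqdist (H l))); first exact: PH.1.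
  exact: continuous_sqdist.
have [g /= g0 hg] : exists2 g : R, 0 < g & forall s, `|l - s| < g -> sqdist (H l) (H s) < D / 4.
  have D4 : 0 < D / 4 by rewrite divr_gt0.
  have /cvgrPdist_lt /(_ _ D4) /nbhs_ballP[g /= g0 hg] := cf l.
  exists g => // s hs; have := hg s hs; rewrite /= sqdist_xx sub0r normrN.
  by apply: le_lt_trans; exact: ler_norm.
have Ul : nbhs l (ball l g) by exact: nbhsx_ballx.
have infU := (limit_point_infinite_setP E l).1 El _ Ul.
have [a1 [a2 [B1 B2 a12]]] : exists a1 a2, [/\ (ball l g `&` E) a1,
    (ball l g `&` E) a2 & a1 < a2].
  have [a1 B1] : (ball l g `&` E) !=set0.
    by apply/set0P/eqP => h; apply: infU; rewrite h; exact: finite_set0.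
  have [a2 [B2 /eqP na]] : ((ball l g `&` E) `\` [set a1]) !=set0.
    apply/set0P/eqP => h; apply: infU; apply: (@sub_finite_set _ _ [set a1]).
      by move=> z Bz; apply: contrapT => nz; rewrite -[False]/(set0 z) -h.
    exact: finite_set1.
  by have [a12|a21|a12] := ltgtP a1 a2; [exists a1, a2|exists a2, a1|
    rewrite a12 eqxx in na].
have [b1 [_ [dl1 [e1 [d1 A1]]]]] := B1; have [b2 [_ [dl2 [e2 [d2 A2]]]]] := B2.
have dn : dl1 != 0 by rewrite -normr_gt0 d1.
have e1a := arc_disjoint dn A1 A2 a12.
have [ae _ _ _ [ o [ho he arc]]] := A1.
have /arc[s /andP[s0 s1] hs] : exists2 v, 0 <= v <= 1 &
    rotation (v * dl1) o (H a1) = rotation (dl1 / 2) o (H a1).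
  by exists (1 / 2); [apply/andP; split; lra|congr rotation; field].
have : sqdist (H a1) (H s) = D.
  rewrite hs sqdist_rotation_self ho /D; congr (_ * (_ - _) * _).
  rewrite -d1 -[in RHS](ger0_norm (x := 2)) // -normf_div.
  by case: (ger0P (dl1 / 2)) => _; rewrite ?cosN.
have := sqdist_triangle (H a1) (H l) (H s).
have h1 := hg _ b1.
have h2 : sqdist (H l) (H s) < D / 4.
  apply: hg; move: b1 b2; rewrite /ball /= !ltr_norml => /andP[? ?] /andP[? ?].
  by apply/andP; split; lra.
by lra.
Qed.

End Pieces.

Section Mirror.
Variables (H : R -> plane R) (p : plane R) (T b c d : R) (psi psi' : R -> R).
Hypotheses (PH : periodic_param H) (rf : radial_form H p T b c d psi psi').
(** The reflection that exchanges the two branches, as a relation: this avoids inverses of [psi] and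
    [psi'], and makes symmetry immediate. *)
Definition mirror s s' := exists2 u, 0 <= u <= 1 &
  (s = psi u /\ s' = psi' u) \/ (s = psi' u /\ s' = psi u).

Lemma mirror_sym s s' : mirror s s' -> mirror s' s.
Proof. by move=> [u u01 [[-> ->]|[-> ->]]]; exists u; auto. Qed.

Lemma psi_le u : 0 <= u <= 1 -> T <= psi u <= b.
Proof.
move=> /andP[u0 u1]; rewrite -{1}(rf_psi0 rf) -(rf_psi1 rf).
apply/andP; split.
  by move: u0; rewrite le_eqVlt => /predU1P[<- //|u0]; exact/ltW/(rf_incr rf).
have [-> //|un] := eqVneq u 1; apply/ltW/(rf_incr rf) => //.
by rewrite lt_neqAle un.
Qed.

Lemma psi'_le u : 0 <= u <= 1 -> c <= psi' u <= T + 1.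
Proof.
move=> /andP[u0 u1]; rewrite -(rf_psi'0 rf) -{1}(rf_psi'1 rf).
apply/andP; split; last first.
  by move: u0; rewrite le_eqVlt => /predU1P[<- //|u0]; exact/ltW/(rf_decr rf).
have [-> //|un] := eqVneq u 1; apply/ltW/(rf_decr rf) => //.
by rewrite lt_neqAle un.
Qed.

Lemma mirror_decr s1 s1' s2 s2' :
  mirror s1 s1' -> mirror s2 s2' -> s1 < s2 -> s2' < s1'.
Proof.
have bc := rf_bc rf.
have li u v : 0 <= u <= 1 -> 0 <= v <= 1 -> psi u < psi v -> u < v.
  move=> /andP[u0 u1] /andP[v0 v1]; rewrite !ltNge; apply: contra.
  by rewrite le_eqVlt => /predU1P[-> //|h]; apply/ltW/(rf_incr rf).
have li' u v : 0 <= u <= 1 -> 0 <= v <= 1 -> psi' u < psi' v -> v < u.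
  move=> /andP[u0 u1] /andP[v0 v1]; rewrite !ltNge; apply: contra.
  by rewrite le_eqVlt => /predU1P[-> //|h]; apply/ltW/(rf_decr rf).
move=> [u u01 hu] [v v01 hv].
have /andP[pu0 pu1] := psi_le u01; have /andP[qu0 qu1] := psi'_le u01.
have /andP[pv0 pv1] := psi_le v01; have /andP[qv0 qv1] := psi'_le v01.
case: hu => -[-> ->]; case: hv => -[-> ->] h; try lra.
- move: (li _ _ u01 v01 h) => uv; case/andP: u01 => ? _; case/andP: v01 => _ ?.
  exact: (rf_decr rf).
- move: (li' _ _ u01 v01 h) => uv; case/andP: v01 => ? _; case/andP: u01 => _ ?.
  exact: (rf_incr rf).
Qed.

Variable rsq : R.
Hypothesis rsq_gt0 : 0 < rsq.

Lemma radial_form_arc : sqdist p (H b) = rsq -> arc_piece H rsq d b c.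
Proof.
move=> hr; have [Tb bc cT] := And3 (rf_Tb rf) (rf_bc rf) (rf_cT rf).
split; [by []|by lra| | |].
- exact: irregular_arc_start PH rf.
- exact: irregular_arc_end PH rf.
exists p; split=> //; [exact: rf_end rf|exact: rf_arc rf].
Qed.

(** The irregular points [b], [c] and [T + 1] cannot be inside a piece, so it lies in one branch and
    is rotated to the other, or it lies in the central arc. *)
Lemma arc_mirror dl (x : R) e : dl != 0 -> T <= x < T + 1 -> arc_piece H rsq dl x e ->
  (x = b /\ e = c) \/
  exists (y f : R), [/\ x != b, T <= y < T + 1, arc_piece H rsq (- dl) y f, mirror e y & mirror x f].
Proof.
move=> d0 /andP[Tx xT] A; have [xe ex nx ne _] := A.
have [Tb bc cT] := And3 (rf_Tb rf) (rf_bc rf) (rf_cT rf).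
have nb := irregular_arc_start rsq_gt0 PH rf.
have nc := irregular_arc_end rsq_gt0 PH rf.
have nT := irregular_center rsq_gt0 PH rf.
have out s : ~ regular H rsq (H s) -> s <= x \/ e <= s.
  move=> ns; have [sx|xs] := leP s x; [by left|right].
  by rewrite leNgt; apply/negP => se; apply: ns; apply: (arc_interior PH d0 A); rewrite xs.
have eT : e <= T + 1.
  have nT1 : ~ regular H rsq (H (T + 1)) by rewrite paramD1.
  by have [h|//] := out _ nT1; lra.
have [bx|eb] := out b nb; last first.
  have [u1 u101 hu1] : exists2 u, 0 <= u <= 1 & psi u = x.
    by apply: (rf_onto rf); apply/andP; split; lra.
  have [u2 u201 hu2] : exists2 u, 0 <= u <= 1 & psi u = e.
    by apply: (rf_onto rf); apply/andP; split; lra.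
  have m1 : mirror x (psi' u1) by exists u1; auto.
  have m2 : mirror e (psi' u2) by exists u2; auto.
  have lt := mirror_decr m1 m2 xe.
  have /andP[q10 q11] := psi'_le u101; have /andP[q20 q21] := psi'_le u201.
  right; exists (psi' u2), (psi' u1); split=> //.
  - by apply/eqP; lra.
  - by apply/andP; split; lra.
  apply: (arc_rotation (a := d) (p := p) A) => //.
  - by lra.
  - by move/(regular_mirror rsq_gt0 PH rf u201); rewrite hu2.
  - by move/(regular_mirror rsq_gt0 PH rf u101); rewrite hu1.
  - by rewrite (rf_rot rf) // hu2.
  - by rewrite (rf_rot rf) // hu1.
  - move=> s /andP[s0 s1]; have [|u u01 hu] := rf_onto rf (s := s).
      by apply/andP; split; lra.
    exists (psi' u); last by rewrite (rf_rot rf) // hu.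
    have ms : mirror s (psi' u) by exists u; auto.
    apply/andP; split; rewrite leNgt; apply/negP => h.
      by have := mirror_decr (mirror_sym ms) (mirror_sym m2) h; lra.
    by have := mirror_decr (mirror_sym m1) (mirror_sym ms) h; lra.
  - move=> s' /andP[s0 s1]; have [|u u01 hu] := rf_onto' rf (s := s').
      by apply/andP; split; lra.
    exists (psi u); last by rewrite -hu (rf_rot rf).
    have ms : mirror (psi u) s' by exists u; auto.
    apply/andP; split; rewrite leNgt; apply/negP => h.
      by have := mirror_decr ms m1 h; lra.
    by have := mirror_decr m2 ms h; lra.
(* A piece inside [[b, c]] is on the circle of the central arc, which is therefore a maximal arc of
   this radius too; the irregular ends of the piece must be its ends. *)
have [cx|ec] := out c nc; last first.
  have Am : x = b /\ e = c; last by left.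
  have [ o _ ho] := arc_circle A.
  have pcirc s : x <= s <= e -> sqdist p (H s) = sqdist p (H b).
    move=> /andP[s0 s1]; have /(rf_arc rf)[v _ <-] : exists2 s', b <= s' <= c & H s' = H s.
      by exists s => //; apply/andP; split; lra.
    by rewrite sqdist_rotation_center.
  have op : o = p.
    apply: (@circle_center_param _ _ PH x x ((x + e) / 2) e o p rsq (sqdist p (H b))); try lra.
    have key s : x <= s <= e -> sqdist o (H s) = rsq /\ sqdist p (H s) = sqdist p (H b).
      by move=> sxe; split; [exact: ho|exact: pcirc].
    by move=> s; rewrite !inE => /or3P[] /eqP ->; apply: key; apply/andP; split; lra.
  have hr : sqdist p (H b) = rsq.
    by rewrite -(pcirc x) -?op ?ho // lexx ltW.
  have M := radial_form_arc hr.
  have dn := rf_angle0 rf.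
  have inM s : ~ regular H rsq (H s) -> s <= b \/ c <= s.
    move=> ns; have [sb|bs] := leP s b; [by left|right].
    by rewrite leNgt; apply/negP => sc; apply: ns; apply: (arc_interior PH dn M); rewrite bs.
  by have := inM x nx; have := inM e ne; split; lra.
have [u1 u101 hu1] : exists2 u, 0 <= u <= 1 & psi' u = x.
  by apply: (rf_onto' rf); apply/andP; split; lra.
have [u2 u201 hu2] : exists2 u, 0 <= u <= 1 & psi' u = e.
  by apply: (rf_onto' rf); apply/andP; split; lra.
have m1 : mirror x (psi u1) by exists u1; auto.
have m2 : mirror e (psi u2) by exists u2; auto.
have lt := mirror_decr m1 m2 xe.
have /andP[q10 q11] := psi_le u101; have /andP[q20 q21] := psi_le u201.
have rot u : 0 <= u <= 1 -> H (psi u) = rotation (- d) p (H (psi' u)).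
  by move=> u01; rewrite (rf_rot rf) // rotationK.
right; exists (psi u2), (psi u1); split=> //.
- by apply/eqP; lra.
- by apply/andP; split; lra.
apply: (arc_rotation (a := - d) (p := p) A) => //.
- by lra.
- by move/(regular_mirror rsq_gt0 PH rf u201); rewrite hu2.
- by move/(regular_mirror rsq_gt0 PH rf u101); rewrite hu1.
- by rewrite rot // hu2.
- by rewrite rot // hu1.
- move=> s /andP[s0 s1]; have [|u u01 hu] := rf_onto' rf (s := s).
    by apply/andP; split; lra.
  exists (psi u); last by rewrite rot // hu.
  have ms : mirror s (psi u) by exists u; auto.
  apply/andP; split; rewrite leNgt; apply/negP => h.
    by have := mirror_decr (mirror_sym ms) (mirror_sym m2) h; lra.
  by have := mirror_decr (mirror_sym m1) (mirror_sym ms) h; lra.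
- move=> s' /andP[s0 s1]; have [|u u01 hu] := rf_onto rf (s := s').
    by apply/andP; split; lra.
  exists (psi' u); last by rewrite -hu rot.
  have ms : mirror (psi' u) s' by exists u; auto.
  apply/andP; split; rewrite leNgt; apply/negP => h.
    by have := mirror_decr ms m1 h; lra.
  by have := mirror_decr m2 ms h; lra.
Qed.

End Mirror.
End Arcs.

(** * Order-reversing involutions of a finite cyclic set *)

Section CyclicReflections.
Variable R : realType.
Implicit Types (T x y m : R) (f g S : R -> R).

Section Window.
Variables (X : set R) (T : R) (s : seq R).
Hypothesis XD1 : forall x, X (x + 1) <-> X x.
Hypothesis us : uniq s.
Hypothesis ms : forall x, (x \in s) <-> X x /\ T <= x < T + 1.

(* The number of points of the 1-periodic set X in [T, x[, for x <= T + 2. *)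
Definition rank x : nat := count (fun y => y < x) s + count (fun y => y + 1 < x) s.

Lemma rankD1 x : x \in s -> rank (x + 1) = (size s + rank x)%N.
Proof.
move=> /ms[_ /andP[Tx xT]]; rewrite /rank.
have -> : count (fun y => y < x + 1) s = size s.
  rewrite -(count_predT s); apply: eq_in_count => y /ms[_ /andP[? ?]].
  by have -> : y < x + 1 by lra.
congr addn; rewrite -[LHS]addn0; congr addn.
  by apply: eq_count => y; rewrite ltrD2r.
apply/esym/eqP; rewrite -leqn0 leqNgt -has_count; apply/hasPn => y.
by move=> /ms[_ /andP[? ?]]; rewrite -leNgt; lra.
Qed.

Lemma rank_small x : x \in s -> rank x = count (fun y => y < x) s.
Proof.
move=> /ms[_ /andP[Tx xT]]; rewrite /rank -[RHS]addn0; congr addn.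
apply/eqP; rewrite -leqn0 leqNgt -has_count; apply/hasPn => y.
by move=> /ms[_ /andP[? ?]]; rewrite -leNgt; lra.
Qed.

Lemma rank_lt x : x \in s -> (rank x < size s)%N.
Proof.
move=> xs; rewrite rank_small // -(count_predC (fun y => y < x) s).
rewrite -[ltnLHS]addn0 ltn_add2l -has_count.
by apply/hasP; exists x => //=; rewrite ltxx.
Qed.

Lemma rank_inj : {in s &, injective rank}.
Proof.
have lt x y : x \in s -> y \in s -> x < y -> (rank x < rank y)%N.
  move=> xs ys xy; rewrite !rank_small // -!size_filter.
  have h : [seq z <- s | z < x] = [seq z <- [seq z <- s | z < y] | z < x].
    rewrite -filter_predI; apply: eq_filter => z /=.
    by case: ltP => //= zx; rewrite (lt_trans zx).
  rewrite h; set t := [seq z <- s | z < y].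
  rewrite size_filter -(count_predC (fun z => z < x) t).
  rewrite -[ltnLHS]addn0 ltn_add2l -has_count.
  by apply/hasP; exists x; rewrite /t ?mem_filter ?xy //= ltxx.
move=> x y xs ys e; have [xy|yx|//] := ltgtP x y.
  by have := lt x y xs ys xy; rewrite e ltnn.
by have := lt y x ys xs yx; rewrite e ltnn.
Qed.

Variables (T' : R).
Hypothesis TT' : T <= T' < T + 1.

(** Each generating point reflects the window starting at itself, whereas ranks and sums refer to
    one common window; here are the representatives of the same classes in [[T', T' + 1[]. *)
Definition shifted_window := [seq if x < T' then x + 1 else x | x <- s].
Local Notation s' := shifted_window.

Lemma mem_shifted x : (x \in s') <-> X x /\ T' <= x < T' + 1.
Proof.
have /andP[T1 T2] := TT'; split.
  move=> /mapP[y /ms[Xy /andP[? ?]] ->]; case: ltP => h.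
    by split; [exact/XD1|apply/andP; split; lra].
  by split=> //; apply/andP; split; lra.
move=> [Xx /andP[h1 h2]]; apply/mapP; have [xT|xT] := ltP x (T + 1).
  by exists x; [apply/ms; split=> //; apply/andP; split; lra|rewrite ltNge h1].
exists (x - 1); last by rewrite ltrBlDr h2 subrK.
apply/ms; split; last by apply/andP; split; lra.
by apply/XD1; rewrite subrK.
Qed.

Lemma uniq_shifted : uniq s'.
Proof.
rewrite map_inj_in_uniq // => x y /ms[_ /andP[? ?]] /ms[_ /andP[? ?]].
by case: ltP => h1; case: ltP => h2 e; lra.
Qed.

Lemma sum_shifted (F : R -> R) : (forall x, x \in s -> F (x + 1) = F x) ->
  \sum_(x <- s) F x = \sum_(x <- s') F x.
Proof.
move=> FD; rewrite big_map; apply: eq_big_seq => x xs /=.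
by case: ifP => // _; rewrite FD.
Qed.

Lemma count_sum (a : pred R) (l : seq R) : count a l = (\sum_(y <- l) a y)%N.
Proof. by elim: l => [|z l IH]; rewrite ?big_nil ?big_cons //= IH. Qed.

(** Points before [T'] add a constant and reappear shifted by one period, so ranks in the new window
    are positions up to a constant. *)
Lemma rank_shifted x : T' <= x < T' + 1 ->
  rank x = (count (fun y => y < T')%R s + count (fun y => y < x)%R s')%N.
Proof.
have /andP[T1 T2] := TT'.
move=> /andP[h1 h2]; rewrite /rank /s' count_map.
rewrite !count_sum -!big_split /=; apply: eq_big_seq => y.
move=> /ms[_ /andP[? ?]]; case: (ltP y T') => hy /=.
  have -> : y < x by lra.
  by [].
by have -> : (y + 1 < x) = false by [apply/negbTE; rewrite -leNgt; lra]; rewrite addn0.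
Qed.

Variables (S : R -> R) (f : R -> R) (m : R).
Hypothesis Sin : forall x, x \in s' -> S x \in s'.
Hypothesis SK : forall x, x \in s' -> S (S x) = x.
Hypothesis Slt : forall x y, x \in s' -> y \in s' -> x < y -> S y < S x.
Hypothesis fS : forall x, x \in s' -> x != m -> f (S x) = - f x.
Hypothesis Sm : m \in s' -> S m = m.
Hypothesis fD1 : forall x, f (x + 1) = f x.

Lemma perm_reflection : perm_eq [seq S x | x <- s'] s'.
Proof.
apply: uniq_perm.
- rewrite map_inj_in_uniq ?uniq_shifted // => x y xs ys e.
  by rewrite -(SK xs) e SK.
- exact: uniq_shifted.
move=> x; apply/mapP/idP => [[y ys ->]|xs]; first exact: Sin.
by exists (S x); rewrite ?SK ?Sin.
Qed.

(** Adding the sum to its reindexing by [S] pairs [f x] with [f (S x) = - f x] under equal weights;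
    only the fixed point survives, counted twice. *)
Lemma reflection_sum (g : R -> R) :
  (forall x, x \in s -> g (x + 1) = g x) ->
  (forall x, x \in s' -> g (S x) = g x) ->
  \sum_(x <- s) f x * g x = if m \in s' then f m * g m else 0.
Proof.
move=> gD gS; rewrite sum_shifted; last by move=> x xs; rewrite fD1 gD.
pose F x := f x * g x; rewrite -/(F _).
have e1 : \sum_(x <- s') F x = \sum_(x <- s') F (S x).
  by rewrite -(perm_big _ perm_reflection) /= big_map.
have e2 : \sum_(x <- s') F x + \sum_(x <- s') F x =
    (if m \in s' then F m + F m else 0).
  rewrite {2}e1 -big_split /=.
  have -> : \sum_(x <- s') (F x + F (S x)) =
      \sum_(x <- s') if x == m then F m + F m else 0.
    apply: eq_big_seq => x xs; case: eqVneq => [e|xm].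
      by rewrite e Sm // -e.
    by rewrite /F fS // gS // mulNr subrr.
  rewrite -big_mkcond /=; case: ifP => ms'.
    by rewrite -big_filter filter_pred1_uniq ?uniq_shifted // big_seq1.
  rewrite big1_seq // => x /andP[/eqP -> ms2]; by rewrite ms2 in ms'.
by move: e2; case: ifP => _; rewrite -/(F m); lra.
Qed.

(** As many points lie below [S y] as above [y], so the positions of [y] and [S y] have a sum
    independent of [y]; the fixed point [m] gives its value. *)
Lemma rank_reflection x : m \in s' -> x \in s' ->
  (rank (S x) + rank x = rank m + rank m)%N.
Proof.
have key y : y \in s' ->
    (count (fun z => z < S y)%R s' + count (fun z => z < y)%R s' + 1 = size s')%N.
  move=> ys; have -> : count (fun z => z < S y)%R s' = count (fun z => y < z)%R s'.
    have /permP <- := perm_reflection; rewrite count_map.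
    apply: eq_in_count => z zs /=; apply/idP/idP => h.
      have [//|zy|e] := ltgtP y z; last by rewrite e ltxx in h.
      by have := Slt zs ys zy; rewrite ltNge (ltW h).
    exact: Slt.
  rewrite -(count_predC (fun z => y < z)%R s') -addnA; congr addn.
  have -> : 1%N = count (pred1 y) s' by rewrite count_uniq_mem ?uniq_shifted // ys.
  rewrite -count_predUI [X in (_ + X = _)%N](_ : _ = 0%N); last first.
    apply/eqP; rewrite -leqn0 leqNgt -has_count; apply/hasPn => z _ /=.
    by apply/negP => /andP[h /eqP e]; rewrite e ltxx in h.
  by rewrite addn0; apply: eq_count => z /=; rewrite -leNgt le_eqVlt orbC.
move=> ms' xs; have W y : y \in s' -> T' <= y < T' + 1 by move=> /mem_shifted[].
rewrite !rank_shifted ?W ?Sin //.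
have := key _ xs; have := key _ ms'; rewrite Sm //.
set a := count _ _; set b := count _ _; set c := count _ _; set d := count _ _.
by move=> h1 h2; lia.
Qed.

End Window.
End CyclicReflections.

(** * Signs of the arcs, their Fourier coefficient, and the contradiction *)

Section Final.
Variable R : realType.
Implicit Types (H : R -> plane R) (s t u v w T a b c d e f dl rsq al : R).
Implicit Types (p q o x y : plane R) (psi : R -> R).

Section ArcSum.
Variables (H : R -> plane R) (rsq al T0 : R).
Hypotheses (PH : periodic_param H) (rsq_gt0 : 0 < rsq) (al2 : 0 < al < 2 * pi).

Definition arc_start a := exists dl e, `|dl| = al /\ arc_piece H rsq dl a e.

(** The value 0 outside the family lets a nonzero sign prove membership. By [arc_sign] the order of
    the two tests is immaterial. *)
Definition arc_orientation a : R :=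
  if `[< exists e, arc_piece H rsq al a e >] then 1 else
  if `[< exists e, arc_piece H rsq (- al) a e >] then -1 else 0.

Lemma norm_angle dl : `|dl| = al -> dl = al \/ dl = - al.
Proof.
by move=> <-; case: (ger0P dl) => _; [left|right; rewrite opprK].
Qed.

Lemma angle_neq0 dl : `|dl| = al -> dl != 0.
Proof. by case/andP: al2 => h _; rewrite -normr_gt0 => ->. Qed.

Lemma arc_orientation_pos a e : arc_piece H rsq al a e -> arc_orientation a = 1.
Proof. by move=> A; rewrite /arc_orientation asboolT //; exists e. Qed.

Lemma arc_orientation_neg a e :
  arc_piece H rsq (- al) a e -> arc_orientation a = -1.
Proof.
move=> A; rewrite /arc_orientation asboolF; last first.
  by move=> [e' A']; exact: (arc_sign PH rsq_gt0 al2 A' A).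
by rewrite asboolT //; exists e.
Qed.

Lemma arc_orientationN dl a e b f : `|dl| = al -> arc_piece H rsq dl a e ->
  arc_piece H rsq (- dl) b f -> arc_orientation b = - arc_orientation a.
Proof.
move=> /norm_angle[->|->] A B.
  by rewrite (arc_orientation_pos A) (arc_orientation_neg B).
by rewrite opprK in B; rewrite (arc_orientation_neg A) (arc_orientation_pos B) opprK.
Qed.

Lemma arc_orientation_neq0 a : arc_orientation a != 0 -> arc_start a.
Proof.
rewrite /arc_orientation; case: asboolP => [[e A] _|_].
  by exists al, e; split=> //; rewrite gtr0_norm //; case/andP: al2.
case: asboolP => [[e A] _|_]; last by rewrite eqxx.
by exists (- al), e; split=> //; rewrite normrN gtr0_norm //; case/andP: al2.
Qed.

Lemma arc_shift1 dl a e : arc_piece H rsq dl (a + 1) e <-> arc_piece H rsq dl a (e - 1).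
Proof.
split=> A; first by have := arc_shift PH (-1) A; rewrite mulrN1z addrK.
by have := arc_shift PH 1 A; rewrite subrK.
Qed.

Lemma arc_startD1 a : arc_start (a + 1) <-> arc_start a.
Proof.
split=> -[dl [e [hd A]]]; exists dl.
  by exists (e - 1); split=> //; apply/arc_shift1.
by exists (e + 1); split=> //; apply/arc_shift1; rewrite addrK.
Qed.

Lemma arc_orientationD1 a : arc_orientation (a + 1) = arc_orientation a.
Proof.
have E dl : (exists e, arc_piece H rsq dl (a + 1) e) <->
    (exists e, arc_piece H rsq dl a e).
  split=> -[e A]; first by exists (e - 1); apply/arc_shift1.
  by exists (e + 1); apply/arc_shift1; rewrite addrK.
by rewrite /arc_orientation (asbool_equiv_eq (E _)) (asbool_equiv_eq (E (- al))).
Qed.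

Variable s : seq R.
Hypothesis us : uniq s.
Hypothesis ms : forall a, (a \in s) <-> arc_start a /\ T0 <= a < T0 + 1.

Section Reflection.
Variables (p : plane R) (T b c d : R) (psi psi' : R -> R).
Hypothesis rf : radial_form H p T b c d psi psi'.
Hypothesis TT : T0 <= T < T0 + 1.
Local Notation s' := (shifted_window s T).

Let in_s' := mem_shifted arc_startD1 ms TT.

(** Reversal exchanges starts and ends: the new start [a'] mirrors the end [e], and the new end
    mirrors [a]. The angles [dl] and [dl'] are left unrelated so that the fixed central arc is
    covered too. *)
Let reflected a a' := [/\ a' \in s', a == b -> a' = b,
  a != b -> arc_orientation a' = - arc_orientation a &
  exists dl dl' e e', [/\ `|dl| = al, `|dl'| = al,
    arc_piece H rsq dl a e /\ arc_piece H rsq dl' a' e',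
    mirror psi psi' e a' & mirror psi psi' a e']].

Lemma reflected_exists a : exists a', a \in s' -> reflected a a'.
Proof.
have [as'|] := boolP (a \in s'); last by exists 0.
have [[dl [e [hdl A]]] aT] := (in_s' a).1 as'.
have [[ab ec]|[a' [f [ab a'T B m1 m2]]]] :=
    arc_mirror PH rf rsq_gt0 (angle_neq0 hdl) aT A.
  exists a => _; split=> //; first by rewrite ab eqxx.
  exists dl, dl, e, e; split=> //; rewrite ab ec; exists 1;
    rewrite ?ler01 ?lexx // (rf_psi1 rf) (rf_psi'1 rf); auto.
exists a' => _; split.
- by apply/in_s'; split=> //; exists (- dl), f; rewrite normrN.
- by rewrite (negbTE ab).
- by move=> _; exact: arc_orientationN hdl A B.
by exists dl, (- dl), e, f; rewrite normrN.
Qed.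

Lemma reflection_exists : exists S : R -> R, [/\
  forall a, a \in s' -> S a \in s',
  forall a, a \in s' -> S (S a) = a,
  forall a a', a \in s' -> a' \in s' -> a < a' -> S a' < S a,
  forall a, a \in s' -> a != b -> arc_orientation (S a) = - arc_orientation a &
  b \in s' -> S b = b].
Proof.
have [S hS] := boolp.choice reflected_exists.
have md := mirror_decr rf.
have mfun (x y y' : R) : mirror psi psi' x y -> mirror psi psi' x y' -> y = y'.
  move=> m1 m2; have [h|h|//] := ltgtP y y'.
    by have := md _ _ _ _ (mirror_sym m1) (mirror_sym m2) h; rewrite ltxx.
  by have := md _ _ _ _ (mirror_sym m2) (mirror_sym m1) h; rewrite ltxx.
exists S; split.
- by move=> a /hS[].
- move=> a as'; have [Ss _ _ [dl [dl' [e [e' [h h' [A A'] m1 m2]]]]]] := hS a as'.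
  have [_ _ _ [dl2 [dl2' [e2 [e2' [h2 h2' [A2 A2'] m12 m22]]]]]] := hS (S a) Ss.
  have E := arc_end_unique PH (angle_neq0 h') (angle_neq0 h2) A' A2.
  by rewrite -E in m12; exact: mfun m12 (mirror_sym m2).
- move=> a a' as' as2 aa.
  have [_ _ _ [dl [dl' [e [e' [h h' [A A'] m1 m2]]]]]] := hS a as'.
  have [_ _ _ [dl2 [dl2' [e2 [e2' [h2 h2' [A2 A2'] m12 m22]]]]]] := hS a' as2.
  apply: (md _ _ _ _ m1 m12).
  have := arc_disjoint PH (angle_neq0 h) A A2 aa.
  by move=> /le_lt_trans; apply; case: A2.
- by move=> a /hS[].
- by move=> bs; have [_ h _ _] := hS b bs; exact: h.
Qed.

Lemma sum_orientation : \sum_(a <- s) arc_orientation a = arc_orientation b.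
Proof.
have [S [Sin SK Slt fS Sb]] := reflection_exists.
have := reflection_sum us ms Sin SK fS Sb arc_orientationD1
  (g := fun _ => 1) (fun _ _ => erefl) (fun _ _ => erefl).
under eq_bigr do rewrite mulr1.
(* If [b] is not among the starts of its window, it is outside the family and its sign is 0, like
   the sum. *)
move=> ->; case: ifP; rewrite ?mulr1 // => /negbT/negP nb.
apply/esym/eqP/contraT => /arc_orientation_neq0 ob; exfalso; apply: nb.
apply/in_s'; split=> //; rewrite ltW ?(rf_Tb rf) //.
by rewrite (lt_trans (rf_bc rf)) ?(rf_cT rf).
Qed.

Let N := rank s.
Let kappa : R := 2 * pi / (size s)%:R.

(** The reflection negates [N a - N b], and cosine is even, so the weighted signs still cancel in
    pairs. *)
Lemma sum_orientation_cos : arc_start b ->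
  \sum_(a <- s) arc_orientation a * cos (((N a)%:R - (N b)%:R) * kappa) =
  arc_orientation b.
Proof.
move=> ob; have [S [Sin SK Slt fS Sb]] := reflection_exists.
have bs : b \in s'.
  apply/in_s'; split=> //; rewrite ltW ?(rf_Tb rf) //.
  by rewrite (lt_trans (rf_bc rf)) ?(rf_cT rf).
pose g a := cos (((N a)%:R - (N b)%:R) * kappa).
have s0 : (size s)%:R != 0 :> R.
  rewrite pnatr_eq0; apply/eqP => /size0nil E; move: bs.
  by rewrite E.
have gD a : a \in s -> g (a + 1) = g a.
  move=> as_; rewrite /g /N (rankD1 ms as_) natrD.
  (* One period raises the rank by [size s], which is a full turn of the angle. *)
  rewrite (_ : (_ + _ - _) * kappa = ((rank s a)%:R - (rank s b)%:R) * kappa + pi *+ 2).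
    by rewrite cosD2pi.
  rewrite /kappa -mulr_natl; field.
  by [].
have gS a : a \in s' -> g (S a) = g a.
  move=> as_; have := rank_reflection arc_startD1 us ms TT Sin SK Slt Sb bs as_.
  move=> /(congr1 (fun n => n%:R : R)).
  rewrite (natrD _ (rank s (S a))) (natrD _ (rank s b)) => E.
  rewrite /g -cosN; congr cos; rewrite -mulNr; congr (_ * _).
  by rewrite /N; lra.
have := reflection_sum us ms Sin SK fS Sb arc_orientationD1 gD gS.
by rewrite bs /g subrr mul0r cos0 mulr1.
Qed.

(* The first Fourier coefficient of the orientations lies on the line normal to
   the direction of b. *)
Lemma fourier_coefficient : arc_start b -> exists2 a, a \in s & 
  (b = a \/ b = a + 1) /\
  (\sum_(x <- s) arc_orientation x * cos ((N x)%:R * kappa)) * cos ((N a)%:R * kappa) +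
  (\sum_(x <- s) arc_orientation x * sin ((N x)%:R * kappa)) * sin ((N a)%:R * kappa) =
  arc_orientation b.
Proof.
move=> ob; have bs : b \in s'.
  apply/in_s'; split=> //; rewrite ltW ?(rf_Tb rf) //.
  by rewrite (lt_trans (rf_bc rf)) ?(rf_cT rf).
have key : (\sum_(x <- s) arc_orientation x * cos ((N x)%:R * kappa)) * cos ((N b)%:R * kappa) +
  (\sum_(x <- s) arc_orientation x * sin ((N x)%:R * kappa)) * sin ((N b)%:R * kappa) =
  arc_orientation b.
  rewrite -(sum_orientation_cos ob) !mulr_suml -big_split /=.
  apply: eq_bigr => x _; rewrite mulrBl cosB; ring.
have /mapP[a as_ hb] := bs; exists a => //; split.
  by case: ifP hb; auto.
move: hb key; case: ifP => _ hb; rewrite hb // => <-.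
have s0 : (size s)%:R != 0 :> R.
  rewrite pnatr_eq0; apply/eqP => /size0nil E; move: as_.
  by rewrite E.
have -> : (N (a + 1))%:R * kappa = (N a)%:R * kappa + pi *+ 2.
  by rewrite /N (rankD1 ms as_) natrD /kappa -mulr_natl; field.
by rewrite cosD2pi sinD2pi.
Qed.

End Reflection.
End ArcSum.

(** Arcs with the same start share an initial stretch, hence a circle. Distinct centres therefore
    have distinct arcs. *)
Lemma radial_form_center_unique H (k : int) p T b c d psi psi' p' T' b' c' d' phi phi' :
  periodic_param H -> radial_form H p T b c d psi psi' ->
  radial_form H p' T' b' c' d' phi phi' -> b' = b + k%:~R -> p = p'.
Proof.
move=> PH rf rf' bb; have bc := rf_bc rf; have bc' := rf_bc rf'.
have cT := rf_cT rf; have Tb := rf_Tb rf.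
pose m := Num.min (c - b) (c' - b').
have m0 : 0 < m by rewrite lt_min !subr_gt0 bc bc'.
have mc : m <= c - b by rewrite ge_min lexx.
have mc' : m <= c' - b' by rewrite ge_min lexx orbT.
have key s : b <= s <= b + m ->
    sqdist p (H s) = sqdist p (H b) /\ sqdist p' (H s) = sqdist p' (H b').
  move=> /andP[s0 s1]; split.
    have /(rf_arc rf)[v _ <-] : exists2 s', b <= s' <= c & H s' = H s.
      by exists s => //; apply/andP; split; lra.
    by rewrite sqdist_rotation_center.
  have /(rf_arc rf')[v _ <-] : exists2 s', b' <= s' <= c' & H s' = H s.
    exists (s + k%:~R); first by apply/andP; split; lra.
    by apply/(PH.2 _ _); exists k; rewrite addrAC subrr add0r.
  by rewrite sqdist_rotation_center.
apply: (@circle_center_param _ H PH T b (b + m / 2) (b + m) p p'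
  (sqdist p (H b)) (sqdist p' (H b'))); try lra.
by move=> s; rewrite !inE => /or3P[] /eqP ->; apply: key; apply/andP; split; lra.
Qed.

Lemma no_three_centers H : periodic_param H ->
  forall (p1 p2 p3 : plane R) (T0 T2 T3 b1 b2 b3 c1 c2 c3 d1 d2 d3 : R)
    (psi1 psi1' psi2 psi2' psi3 psi3' : R -> R),
  radial_form H p1 T0 b1 c1 d1 psi1 psi1' ->
  radial_form H p2 T2 b2 c2 d2 psi2 psi2' ->
  radial_form H p3 T3 b3 c3 d3 psi3 psi3' ->
  T0 <= T2 < T0 + 1 -> T0 <= T3 < T0 + 1 ->
  p1 <> p2 -> p1 <> p3 -> p2 <> p3 -> False.
Proof.
move=> PH p1 p2 p3 T0 T2 T3 b1 b2 b3 c1 c2 c3 d1 d2 d3 psi1 psi1' psi2 psi2'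
  psi3 psi3' rf1 rf2 rf3 TT2 TT3 p12 p13 p23.
have TT1 : T0 <= T0 < T0 + 1 by rewrite lexx ltrDl ltr01.
pose rsq := sqdist p1 (H b1).
have rsq_gt0 : 0 < rsq.
  apply: sqdist_gt0; rewrite -(rf_base rf1) => /esym.
  apply: param_neq_base => //; rewrite (rf_Tb rf1) /=.
  by rewrite (lt_trans (rf_bc rf1)) ?(rf_cT rf1).
pose al := `|d1|.
have al2 : 0 < al < 2 * pi by rewrite normr_gt0 (rf_angle0 rf1) (rf_angle rf1).
have [s0 hs0] := (finite_seqP _).1 (arc_starts_finite PH T0 rsq_gt0 al2).
pose s := undup s0.
have us : uniq s := undup_uniq s0.
have ms a : (a \in s) <-> arc_start H rsq al a /\ T0 <= a < T0 + 1.
  rewrite mem_undup; have : [set` s0] a <-> (T0 <= a < T0 + 1 /\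
    exists dl e, `|dl| = al /\ arc_piece H rsq dl a e) by rewrite -hs0.
  by rewrite /arc_start /=; tauto.
have A1 := radial_form_arc PH rf1 rsq_gt0 (erefl rsq).
have o1 : arc_orientation H rsq al b1 != 0.
  have [e|e] := norm_angle (erefl al); rewrite e in A1.
    by rewrite (arc_orientation_pos A1) oner_eq0.
  by rewrite (arc_orientation_neg PH rsq_gt0 al2 A1) oppr_eq0 oner_eq0.
have E1 := sum_orientation PH rsq_gt0 al2 us ms rf1 TT1.
have E2 := sum_orientation PH rsq_gt0 al2 us ms rf2 TT2.
have E3 := sum_orientation PH rsq_gt0 al2 us ms rf3 TT3.
have st1 := arc_orientation_neq0 al2 o1.
(* The sum of signs is nonzero because of the first arc, and it is also the sign at [b2] and at
   [b3]; so these arcs have the same radius and angle. *)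
have st2 : arc_start H rsq al b2 by apply: arc_orientation_neq0; rewrite // -E2 E1.
have st3 : arc_start H rsq al b3 by apply: arc_orientation_neq0; rewrite // -E3 E1.
have [a1 as1 [ba1 F1]] := fourier_coefficient PH rsq_gt0 al2 us ms rf1 TT1 st1.
have [a2 as2 [ba2 F2]] := fourier_coefficient PH rsq_gt0 al2 us ms rf2 TT2 st2.
have [a3 as3 [ba3 F3]] := fourier_coefficient PH rsq_gt0 al2 us ms rf3 TT3 st3.
have shift (x y z : R) : (x = z \/ x = z + 1) -> (y = z \/ y = z + 1) ->
    exists k : int, y = x + k%:~R.
  move=> [->|->] [->|->]; [exists 0|exists 1|exists (-1)|exists 0];
    rewrite ?mulrN1z ?addr0 ?addrK //.
have n12 : a1 <> a2.
  move=> e; rewrite -e in ba2; have [k hk] := shift _ _ _ ba1 ba2.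
  by apply: p12; exact: (radial_form_center_unique PH rf1 rf2 hk).
have n13 : a1 <> a3.
  move=> e; rewrite -e in ba3; have [k hk] := shift _ _ _ ba1 ba3.
  by apply: p13; exact: (radial_form_center_unique PH rf1 rf3 hk).
have n23 : a2 <> a3.
  move=> e; rewrite -e in ba3; have [k hk] := shift _ _ _ ba2 ba3.
  by apply: p23; exact: (radial_form_center_unique PH rf2 rf3 hk).
rewrite -E1 in F1; rewrite -E2 in F2; rewrite -E3 in F3.
set kappa := 2 * pi / _ in F1 F2 F3.
set A := \sum_(x <- s) _ * cos _ in F1 F2 F3.
set B := \sum_(x <- s) _ * sin _ in F1 F2 F3.
set E := \sum_(x <- s) _ in F1 F2 F3.
have n_gt0 : 0 < (size s)%:R :> R.
  by rewrite ltr0n lt0n; apply/eqP => /size0nil e; rewrite e in as1.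
pose P a : plane R := (cos ((rank s a)%:R * kappa), sin ((rank s a)%:R * kappa)).
have pi0 := pi_gt0 R.
(* Ranks are below [size s], so two angles differ by less than a full turn. *)
have Pinj a a' : a \in s -> a' \in s -> a <> a' -> P a <> P a'.
  move=> ia ia' na [ec es]; apply: na; apply: (rank_inj ms) => //.
  have c1' : cos ((rank s a)%:R * kappa - (rank s a')%:R * kappa) = 1.
    by rewrite cosB ec es -!expr2 cos2Dsin2.
  have : `|(rank s a)%:R * kappa - (rank s a')%:R * kappa| < 2 * pi.
    rewrite -mulrBl normrM (gtr0_norm (x := kappa)); last by rewrite !mulr_gt0 ?invr_gt0.
    rewrite /kappa mulrA ltr_pdivrMr // mulrC ltr_pM2l ?mulr_gt0 //.
    have := rank_lt ms ia; have := rank_lt ms ia'.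
    rewrite -!(ltr_nat R) => h1 h2.
    have h3 := ler0n R (rank s a); have h4 := ler0n R (rank s a').
    by rewrite ltr_norml; apply/andP; split; lra.
  move=> /(cos_eq1 c1')/eqP; rewrite subr_eq0 => /eqP /mulIf.
  have k0 : kappa != 0 by rewrite mulf_neq0 ?invr_eq0 ?mulf_neq0 ?lt0r_neq0.
  by move=> /(_ k0) /eqP; rewrite eqr_nat => /eqP.
(* The common value [E] is nonzero, so the normal [(A, B)] cannot vanish. *)
apply: (@line_circle _ (0, 0) (A, B) E 1 (P a1) (P a2) (P a3)).
- by move=> [eA eB]; move: F1; rewrite eA eB !mul0r addr0 /E E1 => /esym/eqP; rewrite (negbTE o1).
- exact: Pinj.
- exact: Pinj.
- exact: Pinj.
- by move=> x; rewrite !inE => /or3P[] /eqP -> /=; rewrite mulrC [X in _ + X]mulrC.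
- move=> x; rewrite !inE => /or3P[] /eqP ->;
    by rewrite /sqdist /= !sub0r !sqrrN cos2Dsin2.
Qed.

End Final.

Theorem corollary3p6 (R : realType) :
  ~ exists (T : tile R) (p1 p2 p3 : plane R),
      [/\ p1 <> p2, p1 <> p3 & p2 <> p3] /\
      radially_generated_by3 T p1 p2 p3 /\
      tiles_disk T.
Proof.
move=> [T [p1 [p2 [p3 [[p12 p13 p23] [[g1 g2 g3] _]]]]]].
have [H [PH HT]] := simple_closed_periodic_param (tile_boundary_simple T).
have form p T0 : radially_generated_by_point T p -> exists2 T', T0 <= T' < T0 + 1 &
    exists b c d psi psi', radial_form H p T' b c d psi psi'.
  move=> [eta [a [se ep aa e]]].
  have rp : range H p by rewrite HT e; left; left.
  have [T' TT' hp] := param_window PH T0 rp.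
  exists T' => //; rewrite -hp; rewrite -hp in ep e.
  by apply: radial_form_of_contour PH se ep aa _; rewrite -e HT.
(* The other two base parameters are chosen in the window of the first, which is the common window
   for the ranks. *)
have [T1 _ [b1 [c1 [d1 [psi1 [psi1' rf1]]]]]] := form p1 0 g1.
have [T2 TT2 [b2 [c2 [d2 [psi2 [psi2' rf2]]]]]] := form p2 T1 g2.
have [T3 TT3 [b3 [c3 [d3 [psi3 [psi3' rf3]]]]]] := form p3 T1 g3.
exact: (no_three_centers PH rf1 rf2 rf3 TT2 TT3 p12 p13 p23).
Qed.
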